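(* Let $(\Delta,T,\mu)$ be a uniform Young tower with exponential tails. Then it satisfies an exponential concentration inequality: there exists $C>0$ such that, for any integer $n\ge 1$ and any separately Lipschitz function $K:\Delta^n\to\mathbb{R}$, $(x_0,\dots,x_{n-1})\mapsto K(x_0,\dots,x_{n-1})$, $$\int_\Delta e^{K(x,Tx,\dots,T^{n-1}x)}\,d\mu(x)\;\le\; e^{\int_\Delta K(x,Tx,\dots,T^{n-1}x)\,d\mu(x)}\; e^{C\sum_{i=0}^{n-1}\mathrm{Lip}_i(K)^2}.$$
   Context: Separately Lipschitz: for a metric space $(X,d)$, a function $K$ on $X^n$ is separately Lipschitz if for each $i$ there is a constant $\mathrm{Lip}_i(K)$ with $|K(x_0,\dots,x_i,\dots,x_{n-1})-K(x_0,\dots,x_i',\dots,x_{n-1})|\le \mathrm{Lip}_i(K)\,d(x_i,x_i')$ for all points (the two arguments differ only in coordinate $i$). Uniform Young tower: a space $\Delta$ with a map $T:\Delta\to\Delta$ such that: (1) $\Delta$ is partitioned into (measurable) subsets $\Delta_{\alpha,\ell}$, for $\alpha\in\mathbb{N}$ and integers $0\le \ell\le\phi(\alpha)-1$, where $\phi$ is a positive integer-valued return time function. $T$ maps $\Delta_{\alpha,\ell}$ bijectively onto $\Delta_{\alpha,\ell+1}$ if $\ell<\phi(\alpha)-1$, and maps $\Delta_{\alpha,\phi(\alpha)-1}$ bijectively onto the basis $\Delta_0:=\bigcup_\alpha\Delta_{\alpha,0}$ (these bijections being bimeasurable). (2) The distance is $d(x,y)=\beta^{s(x,y)}$, where $0<\beta<1$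 is fixed and $s(x,y)$ is the smallest $n\ge 0$ such that $T^nx$ and $T^ny$ are not in the same element of the partition. (3) There is a $T$-invariant probability measure $\mu$ such that the inverse $g$ of the jacobian of $T$ with respect to $\mu$ (i.e. $\int u\cdot v\circ T\,d\mu=\int \big(\sum_{Ty=x}g(y)u(y)\big)v(x)\,d\mu(x)$) satisfies, for some constant $C$, $|g(x)/g(y)-1|\le C\,d(Tx,Ty)$ for all $x,y$ in the same partition element. (4) $\gcd\{\phi(\alpha):\alpha\in\mathbb{N}\}=1$. Exponential tails: writing $\phi(x)=\phi(\alpha)$ for $x\in\Delta_{\alpha,0}$, there exists $c_0>0$ with $\int_{\Delta_0}e^{c_0\phi}\,d\mu<\infty$. *)

(* Defs.v *)
From HB Require Import structures.
From mathcomp Require Import all_boot all_order all_algebra.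
From mathcomp Require Import all_classical all_reals all_analysis.

Set Implicit Arguments.
Unset Strict Implicit.
Unset Printing Implicit Defensive.

Import Order.TTheory GRing.Theory Num.Theory.

Local Open Scope classical_set_scope.
Local Open Scope ring_scope.

(* A point of X^n is a function 'I_n -> X; Lip i is any admissible constant for
   the i-th coordinate. *)
Definition separately_lipschitz (R : realType) (X : Type) (dist : X -> X -> R)
    (n : nat) (K : ('I_n -> X) -> R) (Lip : 'I_n -> R) : Prop :=
  forall (i : 'I_n) (x x' : 'I_n -> X),
    (forall j : 'I_n, j != i -> x j = x' j) ->
    `|K x - K x'| <= Lip i * dist (x i) (x' i).

Definition bimeasurable_bij (d : measure_display) (X : measurableType d)
    (A B : set X) (f : X -> X) : Prop :=
  [/\ set_bij A B f,
      measurable_fun A f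
    & forall E : set X, E `<=` A -> measurable E -> measurable (f @` E)].

Definition is_family_gcd (I : Type) (phi : I -> nat) (g : nat) : Prop :=
  (forall a : I, g %| phi a)%N /\
  (forall k : nat, (forall a : I, k %| phi a) -> k %| g)%N.

(* In a tower, (alpha, l) indexes a floor only when l < phi alpha; the value of
   cell alpha l for other indices is irrelevant. *)
Definition floors (phi : nat -> nat) : set (nat * nat) :=
  [set al | (al.2 < phi al.1)%N].

Definition same_cell (X : Type) (cell : nat -> nat -> set X)
    (phi : nat -> nat) (x y : X) : Prop :=
  exists al : nat * nat,
    [/\ floors phi al, cell al.1 al.2 x & cell al.1 al.2 y].

(* None stands for an infinite separation time. *)
Definition separation_time (X : Type) (T : X -> X)
    (cell : nat -> nat -> set X) (phi : nat -> nat) (x y : X) : option nat :=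
  if pselect (exists n : nat,
       `[< ~ same_cell cell phi (iter n T x) (iter n T y) >]) is left ex
  then Some (ex_minn ex) else None.

(* beta ^ s(x, y), with the convention beta ^ oo = 0. *)
Definition separation_dist (R : realType) (X : Type) (T : X -> X)
    (cell : nat -> nat -> set X) (phi : nat -> nat) (beta : R) (x y : X) : R :=
  if separation_time T cell phi x y is Some n then beta ^+ n else 0.

Record uniform_young_tower (R : realType) (d : measure_display)
    (X : measurableType d) (T : X -> X) (mu : probability X R) : Type :=
  UniformYoungTower {
    cell : nat -> nat -> set X ;
    phi : nat -> nat ;
    beta : R ;
    inv_jac : X -> R ;

    phi_gt0 : forall a, (0 < phi a)%N ;
    cell_partition :
      partition (floors phi) (fun al => cell al.1 al.2) [set: X] ;
    cell_measurable :
      forall a l, (l < phi a)%N -> measurable (cell a l) ;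
    map_up : forall a l, (l.+1 < phi a)%N ->
      bimeasurable_bij (cell a l) (cell a l.+1) T ;
    map_top : forall a,
      bimeasurable_bij (cell a (phi a).-1) (\bigcup_b cell b 0%N) T ;

    beta_itv : 0 < beta < 1 ;
    (* The one metric axiom that does not follow from the formula. *)
    dist_separated : forall x y,
      separation_dist T cell phi beta x y = 0 -> x = y ;

    mu_invariant : forall A, measurable A -> mu (T @^-1` A) = mu A ;
    inv_jac_measurable : measurable_fun [set: X] inv_jac ;
    inv_jac_gt0 : forall x, 0 < inv_jac x ;
    (* For nonnegative u and v both sides always make sense, possibly as +oo;
       this determines the formula for integrable integrands. *)
    inv_jacE : forall u v : X -> R,
      measurable_fun [set: X] u -> measurable_fun [set: X] v ->
      (forall x, 0 <= u x) -> (forall x, 0 <= v x) ->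
      (\int[mu]_x (u x * v (T x))%:E =
       \int[mu]_x (esum (T @^-1` [set x]) (fun y => (inv_jac y * u y)%:E)
                   * (v x)%:E))%E ;
    inv_jac_distortion : exists C : R, forall a l x y, (l < phi a)%N ->
      cell a l x -> cell a l y ->
      `|inv_jac x / inv_jac y - 1|
        <= C * separation_dist T cell phi beta (T x) (T y) ;

    phi_gcd : is_family_gcd phi 1
  }.

Definition tower_base (R : realType) (d : measure_display)
    (X : measurableType d) (T : X -> X) (mu : probability X R)
    (Y : uniform_young_tower T mu) : set X :=
  \bigcup_a cell Y a 0%N.

Definition tower_dist (R : realType) (d : measure_display)
    (X : measurableType d) (T : X -> X) (mu : probability X R)
    (Y : uniform_young_tower T mu) : X -> X -> R :=
  separation_dist T (cell Y) (phi Y) (beta Y).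

(* The default value 0 is only taken outside the base. *)
Definition return_time (R : realType) (d : measure_display)
    (X : measurableType d) (T : X -> X) (mu : probability X R)
    (Y : uniform_young_tower T mu) (x : X) : nat :=
  xget 0%N [set phi Y a | a in [set a | cell Y a 0%N x]].

Definition exponential_tails (R : realType) (d : measure_display)
    (X : measurableType d) (T : X -> X) (mu : probability X R)
    (Y : uniform_young_tower T mu) : Prop :=
  exists2 c0 : R, 0 < c0 &
    (\int[mu]_(x in tower_base Y) (expR (c0 * (return_time Y x)%:R))%:E
       < +oo)%E.

Definition orbit_segment (X : Type) (T : X -> X) (n : nat) (x : X) : 'I_n -> X :=
  fun i => iter i T x.

(* Main.v *)
Require Import Defs.
From HB Require Import structures.
From mathcomp Require Import all_boot all_order all_algebra.
From mathcomp Require Import all_classical all_reals all_analysis.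
From mathcomp Require Import measurable_realfun.
From mathcomp Require Import ring lra zify.

Set Implicit Arguments.
Unset Strict Implicit.
Unset Printing Implicit Defensive.

Import Order.TTheory GRing.Theory Num.Theory.
Import numFieldNormedType.Exports.

Local Open Scope classical_set_scope.
Local Open Scope ring_scope.

(** Read backwards in time, the tower is a Markov chain: from a point [x] it jumps
    to a preimage [y] with probability [g y], where [g] is the inverse of the
    jacobian.  Under the invariant measure, [(T^(n-1) x, ..., T x, x)] is a stationary
    trajectory of this chain, so [K (x, T x, ..., T^(n-1) x)] is a functional of the
    trajectory and is studied through its successive conditional expectations
    [F p], in which the first [p] coordinates of [K] are averaged out given the
    others ([cond]).

    The key fact is that the chain forgets its starting point.  Two copies of it
    are coupled ([pback]): independently while they are in different cells, and
    with the largest possible probability of choosing the same branch once they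
    share a cell.  As long as they stay together their distance is multiplied by
    [beta] at each step, and by bounded distortion the probability of separating is
    at most proportional to the distance.  Separated chains come back to low
    heights, because of the exponential tails, and then meet with a probability
    bounded below, because the return times have gcd [1].  A Harris type argument
    with the functional [lyap] turns this into [exponential_mixing]: the mean
    distance after [n] steps is at most [C1 * rho ^ n] times an exponential of the
    initial heights.

    Hence the conditional expectation [F p] varies with its first coordinate by at
    most [sum_j Lip_j * min (1, C * rho ^ (p - j) * exp (s * height))].  This bound
    grows linearly with the height, so that, when all the [Lip_j] are below
    some [eps], its exponential is integrable and one step of the chain satisfies
    [E (exp F_p | future) <= exp (F_(p+1) + C * sum_j Lip_j ^ 2 * rho ^ (p - j))]
    ([exp_step]).  Multiplying these inequalities yields the total cost
    [C * sum_j Lip_j ^ 2] ([small_concentration]); after infinitely many steps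
    [F p] has become the constant [E K].  Finally a coordinate with [Lip_j > eps]
    may be frozen, since this changes [K] by at most
    [Lip_j <= Lip_j ^ 2 / eps].

    The jacobian sums to [1] over preimages only almost everywhere; dividing it by
    its sum gives a chain defined at every point, with comparable distortion
    ([young_backward]), so that no null set has to be followed along the orbits. *)

(** * Positive kernels *)

Lemma esumZl (R : realType) (I : choiceType) (D : set I) (c : R)
    (a : I -> \bar R) : 0 <= c -> (forall i, 0 <= a i)%E ->
  (\esum_(i in D) (c%:E * a i) = c%:E * \esum_(i in D) a i)%E.
Proof.
move=> c0 a0.
have up (k : R) (b : I -> \bar R) : 0 <= k -> (forall i, 0 <= b i)%E ->
    (\esum_(i in D) (k%:E * b i) <= k%:E * \esum_(i in D) b i)%E.
  move=> k0 b0; apply: ge_ereal_sup => _ /= [A [finA AD] <-].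
  rewrite -ge0_mule_fsumr//; apply: lee_wpmul2l; first by rewrite lee_fin.
  by apply: ereal_sup_ubound; exists A.
apply/eqP; rewrite eq_le up//=.
have [->|cn0] := eqVneq c 0.
  by rewrite mul0e; apply: esum_ge0 => i _; rewrite mul0e.
have cp : 0 < c by rewrite lt_neqAle eq_sym cn0.
have ca0 i : (0 <= c%:E * a i)%E by rewrite mule_ge0.
have /= := up c^-1 _ _ ca0; rewrite invr_ge0 => /(_ c0) H.
rewrite [X in (c%:E * X)%E](_ : _ = \esum_(i in D) (c^-1%:E * (c%:E * a i)))%E.
  rewrite -[leRHS]mul1e -[in leRHS](divff cn0) EFinM -muleA.
  by apply: lee_wpmul2l; rewrite ?lee_fin.
by apply: eq_esum => i _; rewrite muleA -EFinM mulVf// mul1e.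
Qed.

(** Values in the extended reals make every sum meaningful, so that kernels can be
    applied to unbounded weights without integrability conditions. *)
Section kernel.
Variables (R : realType) (Z : Type) (I : choiceType).
Variables (wt : Z -> I -> R) (mv : Z -> I -> Z).

Definition kernel_op (f : Z -> \bar R) (z : Z) : \bar R :=
  (\esum_(i in [set: I]) ((wt z i)%:E * f (mv z i)))%E.

Local Notation P := kernel_op.

Hypothesis wt_ge0 : forall z i, 0 <= wt z i.

Lemma kernel_ge0 f : (forall z, 0 <= f z)%E -> forall z, (0 <= P f z)%E.
Proof. by move=> f0 z; apply: esum_ge0 => i _; rewrite mule_ge0 ?lee_fin. Qed.

Lemma le_kernel_at f g z : (forall i, f (mv z i) <= g (mv z i))%E ->
  (P f z <= P g z)%E.
Proof.
by move=> fg; apply: le_esum => i _; apply: lee_wpmul2l; rewrite ?lee_fin.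
Qed.

Lemma le_kernel f g : (forall z, f z <= g z)%E -> forall z, (P f z <= P g z)%E.
Proof. by move=> fg z; apply: le_kernel_at. Qed.

Lemma kernelD f g z : (forall z, 0 <= f z)%E -> (forall z, 0 <= g z)%E ->
  P (fun z => f z + g z)%E z = (P f z + P g z)%E.
Proof.
move=> f0 g0; rewrite /kernel_op -esumD; last 2 first.
- by move=> i _; rewrite mule_ge0 ?lee_fin.
- by move=> i _; rewrite mule_ge0 ?lee_fin.
by apply: eq_esum => i _; rewrite ge0_muleDr.
Qed.

Lemma kernelZ f z (c : R) : 0 <= c -> (forall z, 0 <= f z)%E ->
  P (fun z => c%:E * f z)%E z = (c%:E * P f z)%E.
Proof.
move=> c0 f0; rewrite /kernel_op -esumZl//; last first.
  by move=> i; rewrite mule_ge0 ?lee_fin.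
by apply: eq_esum => i _; rewrite muleCA.
Qed.

Lemma iter_kernel_ge0 f n : (forall z, 0 <= f z)%E ->
  forall z, (0 <= iter n P f z)%E.
Proof. by move=> f0; elim: n => //= n IH; exact: kernel_ge0. Qed.

Lemma le_iter_kernel f g n : (forall z, f z <= g z)%E ->
  forall z, (iter n P f z <= iter n P g z)%E.
Proof. by move=> fg; elim: n => //= n IH; exact: le_kernel. Qed.

Lemma iter_kernelD f g n z : (forall z, 0 <= f z)%E -> (forall z, 0 <= g z)%E ->
  iter n P (fun z => f z + g z)%E z = (iter n P f z + iter n P g z)%E.
Proof.
move=> f0 g0; elim: n z => //= n IH z.
rewrite -kernelD; [|exact: iter_kernel_ge0|exact: iter_kernel_ge0].
by congr (P _ z); apply/funext.
Qed.

Lemma iter_kernelZ f n z (c : R) : 0 <= c -> (forall z, 0 <= f z)%E ->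
  iter n P (fun z => c%:E * f z)%E z = (c%:E * iter n P f z)%E.
Proof.
move=> c0 f0; elim: n z => //= n IH z.
rewrite -kernelZ//; last exact: iter_kernel_ge0.
by congr (P _ z); apply/funext.
Qed.

Hypothesis wt_sum : forall z, (\esum_(i in [set: I]) (wt z i)%:E = 1)%E.

Lemma kernel_cst (c : R) z : 0 <= c -> P (fun=> c%:E) z = c%:E.
Proof.
move=> c0; rewrite /kernel_op.
rewrite (eq_esum (b := fun i => c%:E * (wt z i)%:E)%E); last first.
  by move=> i _; rewrite muleC.
by rewrite esumZl// ?wt_sum ?mule1// => i; rewrite lee_fin.
Qed.

Lemma iter_kernel_cst (c : R) n z : 0 <= c -> iter n P (fun=> c%:E) z = c%:E.
Proof.
move=> c0; elim: n z => //= n IH z; rewrite -[RHS](kernel_cst z c0).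
by congr (P _ z); apply/funext.
Qed.

(** A one-step affine drift bound iterates, the additive constants summing to a
    geometric series. *)
Lemma iter_kernel_drift (V : Z -> R) (ga M : R) :
  0 <= ga < 1 -> 0 <= M -> (forall z, 0 <= V z) ->
  (forall z, P (EFin \o V) z <= (ga * V z + M)%:E)%E ->
  forall n z, (iter n P (EFin \o V) z <= (ga ^+ n * V z + M / (1 - ga))%:E)%E.
Proof.
move=> /andP[ga0 ga1] M0 V0 drift n z.
have ga1' : 0 < 1 - ga by rewrite subr_gt0.
pose b k := M * (1 - ga ^+ k) / (1 - ga).
have gak k : ga ^+ k <= 1 by rewrite exprn_ile1// ltW.
have b0 k : 0 <= b k by rewrite divr_ge0 ?mulr_ge0 ?subr_ge0 // ltW.
suff H k y : (iter k P (EFin \o V) y <= (ga ^+ k * V y + b k)%:E)%E.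
  apply: le_trans (H n z) _; rewrite lee_fin lerD2l /b.
  rewrite ler_pM2r ?invr_gt0// ler_piMr// lerBlDr lerDl exprn_ge0//.
elim: k y => [y|k IH y /=]; first by rewrite /b expr0 subrr mulr0 mul0r mul1r addr0.
apply: le_trans (le_kernel IH y) _.
rewrite (_ : (fun _ => _) =
  (fun z => (ga ^+ k)%:E * (EFin \o V) z + (b k)%:E)%E); last first.
  by apply/funext => x; rewrite /= -EFinM -EFinD.
rewrite kernelD; last 2 first.
- by move=> x; rewrite /= lee_fin mulr_ge0 ?exprn_ge0.
- by move=> x; rewrite lee_fin.
rewrite kernel_cst// kernelZ ?exprn_ge0//.
apply: (@le_trans _ _ ((ga ^+ k)%:E * (ga * V y + M)%:E + (b k)%:E)%E).
  by rewrite leeD2r// lee_wpmul2l// lee_fin exprn_ge0.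
rewrite -EFinM -EFinD lee_fin le_eqVlt; apply/orP; left; apply/eqP.
by rewrite /b exprS; field; rewrite gt_eqF.
Qed.

End kernel.

(** * Couplings of discrete probabilities *)

Lemma esum_pair (R : realType) (I J : choiceType) (f : I -> J -> \bar R) :
  (forall i j, 0 <= f i j)%E ->
  (\esum_(k in [set: I * J]) f k.1 k.2 =
   \esum_(i in [set: I]) \esum_(j in [set: J]) f i j)%E.
Proof.
move=> f0; rewrite esum_esum//; congr esum.
by apply/seteqP; split => -[].
Qed.

Lemma esum_pair_swap (R : realType) (I J : choiceType) (f : I * J -> \bar R) :
  (\esum_(k in [set: I * J]) f k = \esum_(k in [set: J * I]) f (k.2, k.1))%E.
Proof.
apply: (reindex_esum _ _ (fun k : J * I => (k.2, k.1))); split => //.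
- by move=> [i j] [i' j'] _ _ [-> ->].
- by move=> [i j] _; exists (j, i).
Qed.

Section coupling.
Variables (R : realType) (I : choiceType).
Implicit Types (w : I -> R) (q : I * I -> R).

Definition pweight w :=
  (forall i, 0 <= w i) /\ (\esum_(i in [set: I]) (w i)%:E = 1)%E.

Definition coupling w w' q :=
  [/\ forall k, 0 <= q k,
      forall F : I -> \bar R, (forall i, 0 <= F i)%E ->
        (\esum_(k in [set: I * I]) ((q k)%:E * F k.1) =
         \esum_(i in [set: I]) ((w i)%:E * F i))%E
    & forall F : I -> \bar R, (forall i, 0 <= F i)%E ->
        (\esum_(k in [set: I * I]) ((q k)%:E * F k.2) =
         \esum_(i in [set: I]) ((w' i)%:E * F i))%E].

Lemma coupling_sum w w' q : pweight w -> coupling w w' q ->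
  (\esum_(k in [set: I * I]) (q k)%:E = 1)%E.
Proof.
move=> [_ w1] [_ /(_ (fun=> 1%E)) q1 _].
rewrite -w1 -[RHS](eq_esum (a := fun i => (w i)%:E * 1)%E); last first.
  by move=> i _; rewrite mule1.
by rewrite -q1 => [|i]; [apply: eq_esum => k _; rewrite mule1|exact: lee01].
Qed.

Definition prod_coupling w w' (k : I * I) : R := w k.1 * w' k.2.

(** The value [+oo] of [x] is allowed: it is attained since some weight is
    positive. *)
Lemma pweight_avg w (x : \bar R) : pweight w -> (0 <= x)%E ->
  (\esum_(i in [set: I]) ((w i)%:E * x) = x)%E.
Proof.
move=> [w0 w1]; case: x => [x x0|_|//].
  rewrite (eq_esum (b := fun j => x%:E * (w j)%:E)%E).
    by rewrite esumZl// ?w1 ?mule1// => j; rewrite lee_fin.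
  by move=> j _; rewrite muleC.
apply/eqP; rewrite eq_le leey/=.
have [j wj] : exists j, 0 < w j.
  apply: contrapT => /forallNP no; suff : (1 : \bar R)%E = 0%E.
    by move/eqP; rewrite onee_eq0.
  rewrite -w1 esum1// => j _; congr EFin; apply/eqP; rewrite eq_le w0 andbT.
  by rewrite leNgt; apply/negP/no.
apply: esum_ge; exists [set j]; first by split.
by rewrite fsbig_set1 gt0_muley ?lte_fin.
Qed.

Lemma prod_marginal (u : I -> R) w (F : I -> \bar R) :
  (forall i, 0 <= u i) -> pweight w -> (forall i, 0 <= F i)%E ->
  (\esum_(k in [set: I * I]) ((u k.1 * w k.2)%:E * F k.1) =
   \esum_(i in [set: I]) ((u i)%:E * F i))%E.
Proof.
move=> u0 pw F0.
rewrite (esum_pair (f := fun i j => ((u i * w j)%:E * F i)%E)).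
  apply: eq_esum => i _.
  rewrite (eq_esum (b := fun j => (u i)%:E * ((w j)%:E * F i))%E); last first.
    by move=> j _; rewrite EFinM -muleA.
  rewrite esumZl//; last by move=> j; rewrite mule_ge0// lee_fin; apply pw.1.
  by rewrite pweight_avg.
by move=> i j; rewrite mule_ge0// lee_fin mulr_ge0//; apply pw.1.
Qed.

Lemma prod_couplingP w w' : pweight w -> pweight w' ->
  coupling w w' (prod_coupling w w').
Proof.
move=> pw pw'; split=> [k|F F0|F F0].
- by rewrite mulr_ge0//; [apply pw.1|apply pw'.1].
- by apply: prod_marginal => //; apply pw.1.
- rewrite -(prod_marginal _ pw F0); last by apply pw'.1.
  by rewrite esum_pair_swap; apply: eq_esum => -[i j] _; rewrite /= mulrC.
Qed.

(** The mass [overlap] is sent on the diagonal; what is left of each marginal is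
    coupled independently.  If nothing is left, the division by [0] is harmless
    because the leftovers vanish. *)
Definition overlap w w' i : R := Num.min (w i) (w' i).

Definition leftover w w' : R :=
  1 - fine (\esum_(i in [set: I]) (overlap w w' i)%:E).

Definition remainder w w' (k : I * I) : R :=
  (w k.1 - overlap w w' k.1) * (w' k.2 - overlap w w' k.2) / leftover w w'.

Definition max_coupling w w' (k : I * I) : R :=
  (if k.1 == k.2 then overlap w w' k.1 else 0) + remainder w w' k.

Lemma overlapC w w' : overlap w w' = overlap w' w.
Proof. by apply/funext => i; rewrite /overlap minC. Qed.

Lemma leftoverC w w' : leftover w w' = leftover w' w.
Proof. by rewrite /leftover overlapC. Qed.

Lemma remainderC w w' i j : remainder w w' (i, j) = remainder w' w (j, i).
Proof. by rewrite /remainder leftoverC overlapC/= [X in X / _]mulrC. Qed.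

Lemma overlap_ge0 w w' i : pweight w -> pweight w' -> 0 <= overlap w w' i.
Proof. by move=> [w0 _] [w'0 _]; rewrite le_min w0 w'0. Qed.

Lemma overlap_le w w' i : 0 <= w i - overlap w w' i.
Proof. by rewrite subr_ge0 ge_min lexx. Qed.

Lemma leftoverE w w' : pweight w -> pweight w' ->
  (\esum_(i in [set: I]) (w i - overlap w w' i)%:E = (leftover w w')%:E)%E.
Proof.
move=> pw pw'; set s := (LHS).
pose t := (\esum_(i in [set: I]) (overlap w w' i)%:E)%E.
have t0 : (0 <= t)%E by apply: esum_ge0 => i _; rewrite lee_fin overlap_ge0.
have st : (s + t = 1)%E.
  rewrite -esumD; first by rewrite -pw.2; apply: eq_esum => i _; rewrite -EFinD subrK.
  - by move=> i _; rewrite lee_fin overlap_le.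
  - by move=> i _; rewrite lee_fin overlap_ge0.
have s0 : (0 <= s)%E by apply: esum_ge0 => i _; rewrite lee_fin overlap_le.
have : t \is a fin_num.
  by rewrite ge0_fin_numE// (le_lt_trans _ (ltry 1))// -st leeDr.
rewrite /leftover -/t; case: t t0 st => // r r0 st _ /=.
by rewrite EFinB -st -EFinN -addeA -EFinD subrr adde0.
Qed.

Lemma leftover_ge0 w w' : pweight w -> pweight w' -> 0 <= leftover w w'.
Proof.
move=> pw pw'; rewrite -lee_fin -leftoverE//; apply: esum_ge0 => i _.
by rewrite lee_fin overlap_le.
Qed.

Lemma remainder_ge0 w w' k : pweight w -> pweight w' -> 0 <= remainder w w' k.
Proof.
move=> pw pw'; rewrite divr_ge0 ?leftover_ge0// mulr_ge0 ?overlap_le//.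
by rewrite overlapC overlap_le.
Qed.

(** After division by [leftover], the second factor of [remainder] is a probability,
    which disappears when it is summed. *)
Lemma remainder_marginal w w' (F : I -> \bar R) : pweight w -> pweight w' ->
  (forall i, 0 <= F i)%E ->
  (\esum_(k in [set: I * I]) ((remainder w w' k)%:E * F k.1) =
   \esum_(i in [set: I]) ((w i - overlap w w' i)%:E * F i))%E.
Proof.
move=> pw pw' F0; have r0 := leftover_ge0 pw pw'.
have [rz|rn0] := eqVneq (leftover w w') 0.
  rewrite esum1; last by move=> k _; rewrite /remainder rz invr0 mulr0 mul0e.
  rewrite esum1// => i _.
  suff -> : w i - overlap w w' i = 0 by rewrite mul0e.
  apply/eqP; rewrite eq_le overlap_le andbT -lee_fin -[leRHS]/0%:E -rz -leftoverE//.
  apply: esum_ge; exists [set i]; first by split.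
  by rewrite fsbig_set1.
pose w'' i := (w' i - overlap w w' i) / leftover w w'.
have p'' : pweight w''.
  split=> [i|]; first by rewrite divr_ge0// overlapC overlap_le.
  rewrite (eq_esum
    (b := fun i => (leftover w w')^-1%:E * (w' i - overlap w' w i)%:E)%E).
    rewrite esumZl ?invr_ge0//; last by move=> i; rewrite lee_fin overlap_le.
    by rewrite leftoverE// (leftoverC w') -EFinM mulVf.
  by move=> i _; rewrite /w'' mulrC EFinM overlapC.
rewrite -(prod_marginal _ p'' F0); last by move=> i; exact: overlap_le.
by apply: eq_esum => k _; rewrite /remainder /w'' !mulrA.
Qed.

Lemma max_couplingE w w' (G : I * I -> \bar R) : pweight w -> pweight w' ->
  (forall k, 0 <= G k)%E ->
  (\esum_(k in [set: I * I]) ((max_coupling w w' k)%:E * G k) =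
   \esum_(i in [set: I]) ((overlap w w' i)%:E * G (i, i)) +
   \esum_(k in [set: I * I]) ((remainder w w' k)%:E * G k))%E.
Proof.
move=> pw pw' G0.
have o0 i := overlap_ge0 i pw pw'.
have r0 k := remainder_ge0 k pw pw'.
rewrite (eq_esum (b := fun k : I * I =>
  ((if k.1 == k.2 then overlap w w' k.1 else 0)%:E * G (k.1, k.2) +
   (remainder w w' k)%:E * G k)%E)); last first.
  by move=> [i j] _; rewrite -ge0_muleDl ?lee_fin//; case: ifP.
rewrite esumD; last 2 first.
- by move=> k _; rewrite mule_ge0// lee_fin; case: ifP.
- by move=> k _; rewrite mule_ge0// lee_fin.
congr (_ + _)%E.
rewrite (esum_pair (f := fun i j =>
  ((if i == j then overlap w w' i else 0)%:E * G (i, j))%E)); last first.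
  by move=> i j; rewrite mule_ge0// lee_fin; case: ifP.
apply: eq_esum => i _.
rewrite (esumID [set i])//; last first.
  by move=> j _; rewrite mule_ge0// lee_fin; case: ifP.
rewrite setTI esum_set1 ?eqxx ?mule_ge0 ?lee_fin//.
rewrite esum1 ?adde0// => j [_ /= /eqP]; rewrite eq_sym => /negbTE ->.
by rewrite mul0e.
Qed.

Lemma max_couplingP w w' : pweight w -> pweight w' ->
  coupling w w' (max_coupling w w').
Proof.
move=> pw pw'; have o0 i := overlap_ge0 i pw pw'.
split=> [k|F F0|F F0].
- by rewrite addr_ge0 ?remainder_ge0//; case: ifP.
- rewrite (max_couplingE (G := F \o fst))//= remainder_marginal//.
  rewrite -esumD; first last.
  + by move=> i _; rewrite mule_ge0// lee_fin overlap_le.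
  + by move=> i _; rewrite mule_ge0// lee_fin.
  apply: eq_esum => i _; rewrite -ge0_muleDl ?lee_fin ?overlap_le//.
  by rewrite -EFinD addrC subrK.
- rewrite (max_couplingE (G := F \o snd))//=.
  rewrite [X in (_ + X)%E]esum_pair_swap/=.
  rewrite (eq_esum (a := fun k => (_ * F k.1)%E)
    (b := fun k => ((remainder w' w k)%:E * F k.1)%E)).
    rewrite remainder_marginal// overlapC -esumD; first last.
    + by move=> i _; rewrite mule_ge0// lee_fin overlap_le.
    + by move=> i _; rewrite mule_ge0// lee_fin -overlapC.
    apply: eq_esum => i _; rewrite -ge0_muleDl ?lee_fin ?overlap_le//.
      by rewrite -EFinD addrC subrK.
    by rewrite -overlapC.
  by move=> [i j] _; rewrite remainderC.
Qed.
End coupling.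

(** * Numerical semigroups *)

(** The least gap [k] between two elements of an additive monoid of integers
    divides all of them (otherwise a remainder would be a smaller gap), so it is
    [1]; and two consecutive elements [a], [a + 1] generate everything beyond
    [a ^ 2]. *)
Lemma semigroup_eventually (G : nat -> Prop) :
  G 0%N -> (forall s t, G s -> G t -> G (s + t)%N) ->
  (exists2 s, (0 < s)%N & G s) ->
  (forall k : nat, (forall s, G s -> (k %| s)%N) -> k = 1%N) ->
  exists n0, forall n, (n0 <= n)%N -> G n.
Proof.
move=> G0 GD [s1 s1p Gs1] gcd1.
have Gm q s : G s -> G (q * s)%N.
  by move=> Gs; elim: q => [|q IH]; rewrite ?mul0n// mulSn; exact: GD.
have ex : exists k, (0 < k)%N && `[< exists a, G a /\ G (a + k)%N >].
  by exists s1; rewrite s1p; apply/asboolP; exists 0%N; split.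
case: (ex_minnP ex) => k /andP[kp /asboolP[a [Ga Gak]]] kmin.
have k1 : k = 1%N.
  apply: gcd1 => s Gs; rewrite /dvdn; apply/negPn/negP => r0.
  have : (k <= s %% k)%N.
    apply: kmin; rewrite lt0n r0/=; apply/asboolP.
    exists ((s %/ k) * (a + k))%N; split; first exact: Gm.
    have -> : ((s %/ k) * (a + k) + s %% k = (s %/ k) * a + s)%N.
      by rewrite [X in _ = (_ + X)%N](divn_eq s k) mulnDr addnA.
    by apply: GD => //; exact: Gm.
  by rewrite leqNgt ltn_pmod.
move: Gak; rewrite {}k1 => Ga1; exists (a * a)%N => n nge.
have [a0|ap] := posnP a.
  by move: Ga1; rewrite a0 => G1; rewrite -(muln1 n); exact: Gm.
have rq : (n %% a <= n %/ a)%N.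
  by apply: ltnW; apply: leq_trans (ltn_pmod n ap) _; rewrite leq_divRL.
rewrite (_ : n = ((n %/ a - n %% a) * a + (n %% a) * (a + 1))%N); last first.
  by rewrite {1}(divn_eq n a) mulnBl mulnDr muln1 addnA subnK// leq_mul2r rq orbT.
by apply: GD; exact: Gm.
Qed.

(** * The backward chain of a tower *)

(** The Markov chain that follows the orbits of the tower backwards: from [x] it
    jumps to the preimage [br x a] with probability [wt x a].  A point of the base has
    one preimage at the top of each column [a]; a point above the base has only
    one preimage, for which the index [0] is used.  The label [lab x] consists of the
    column and the floor of [x], and [height a] is the number of floors of the
    column [a]. *)
Record backward_tower (R : realType) (X : Type) := BackwardTower {
  br : X -> nat -> X ;
  wt : X -> nat -> R ;
  lab : X -> nat * nat ;
  dist : X -> X -> R ;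
  height : nat -> nat ;
  rate : R ;
  distort : R ;
  tail : R ;
  moment : R ;
  base_pt : X ;
  wt_pweight : forall x, pweight (wt x) ;
  wt_up : forall x a, (lab x).2 != 0%N -> wt x a = (a == 0%N)%:R ;
  wt_gt0 : forall x a, (lab x).2 = 0%N -> 0 < wt x a ;
  lab_up : forall x a, (lab x).2 != 0%N ->
    lab (br x a) = ((lab x).1, (lab x).2.-1) ;
  lab_base : forall x a, (lab x).2 = 0%N -> lab (br x a) = (a, (height a).-1) ;
  lab_base_pt : (lab base_pt).2 = 0%N ;
  dist_ge0 : forall x y, 0 <= dist x y ;
  dist_le1 : forall x y, dist x y <= 1 ;
  dist_sym : forall x y, dist x y = dist y x ;
  dist_far : forall x y, lab x != lab y -> dist x y = 1 ;
  dist_br : forall x y a b, lab (br x a) = lab (br y b) ->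
    dist (br x a) (br y b) = rate * dist x y ;
  rate_itv : 0 < rate < 1 ;
  distort_ge0 : 0 <= distort ;
  wt_distort : forall x y a, (lab x).2 = 0%N -> (lab y).2 = 0%N ->
    wt x a <= (1 + distort * dist x y) * wt y a ;
  tail_gt0 : 0 < tail ;
  moment_ge1 : 1 <= moment ;
  wt_moment : forall x, (lab x).2 = 0%N ->
    (\esum_(a in [set: nat]) ((wt x a)%:E * (expR (tail * (height a).-1%:R))%:E)
      <= moment%:E)%E ;
  height_gt0 : forall a, (0 < height a)%N ;
  height_gcd : forall k : nat, (forall a, (k %| height a)%N) -> k = 1%N
}.

Section backward.
Variables (R : realType) (X : Type) (S : backward_tower R X).

Local Notation br := (br S).
Local Notation wt := (wt S).
Local Notation lab := (lab S).
Local Notation dist := (dist S).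
Local Notation height := (height S).
Local Notation be := (rate S).
Local Notation C := (distort S).
Local Notation M := (moment S).
Local Notation ht x := (lab x).2.

Definition back := kernel_op wt br.

Lemma wt_ge0 x a : 0 <= wt x a. Proof. by apply (wt_pweight S x).1. Qed.

Lemma wt_sum x : (\esum_(a in [set: nat]) (wt x a)%:E = 1)%E.
Proof. by apply (wt_pweight S x).2. Qed.

Lemma back_up f x : (0 < ht x)%N -> (forall x, 0 <= f x)%E ->
  back f x = f (br x 0%N).
Proof.
rewrite lt0n => hx f0; rewrite /back /kernel_op (esumID [set 0%N])//; last first.
  by move=> a _; rewrite mule_ge0// lee_fin wt_ge0.
rewrite setTI esum_set1 ?wt_up// ?mul1e// esum1 ?adde0//.
by move=> a [_ /= /eqP/negbTE a0]; rewrite wt_up// a0 mul0e.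
Qed.

(** Above the base the chain is deterministic: it goes down its column, and reaches
    the base at the point [b] after as many steps as the height. *)
Lemma back_descend x : exists b, [/\ ht b = 0%N, (lab b).1 = (lab x).1
  & forall f n, (forall x, 0 <= f x)%E ->
      iter (n + ht x) back f x = iter n back f b].
Proof.
move hE : (ht x) => h; elim: h x hE => [|h IH] x hx.
  by exists x; split=> // f n _; rewrite addn0.
have hx0 : ht x != 0%N by rewrite hx.
have [|b [b0 b1 bE]] := IH (br x 0%N); first by rewrite lab_up// hx.
exists b; split => [//||f n f0]; first by rewrite b1 lab_up.
rewrite addnS -bE//= back_up ?hx//.
by apply: iter_kernel_ge0 => // *; exact: wt_ge0.
Qed.

(** ** Exponential weights of the height *)

Section weight.
Variable s : R.
Hypothesis s_itv : 0 < s <= tail S.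

Definition expht x : R := expR (s * (ht x)%:R).

Lemma expht_ge1 x : 1 <= expht x.
Proof.
have /andP[s0 _] := s_itv.
by rewrite -expR0 ler_expR mulr_ge0// ltW.
Qed.

Lemma expht_ge0 x : 0 <= expht x. Proof. exact: expR_ge0. Qed.

Lemma back_expht_base x : ht x = 0%N -> (back (EFin \o expht) x <= M%:E)%E.
Proof.
move=> hx; apply: le_trans (wt_moment hx); apply: le_esum => a _.
rewrite lee_wpmul2l ?lee_fin ?wt_ge0//= /expht lab_base//= ler_expR.
by rewrite ler_wpM2r//; case/andP: s_itv.
Qed.

Lemma back_expht x :
  (back (EFin \o expht) x <= (expR (- s) * expht x + M)%:E)%E.
Proof.
have M0 : 0 <= M by rewrite (le_trans ler01)// moment_ge1.
have [hx|hx] := posnP (ht x).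
  apply: le_trans (back_expht_base hx) _.
  by rewrite lee_fin lerDr mulr_ge0 ?expR_ge0.
rewrite back_up//=; last by move=> y; rewrite lee_fin expR_ge0.
rewrite lee_fin /expht lab_up -?lt0n//= -expRD.
rewrite (_ : s * _.-1%:R = - s + s * (ht x)%:R) ?lerDl//.
by rewrite -[in RHS](prednK hx) -natr1; ring.
Qed.

Lemma decay_itv : 0 <= expR (- s) < 1.
Proof. by rewrite expR_ge0 expR_lt1 oppr_lt0; case/andP: s_itv. Qed.

End weight.

(** ** Aperiodicity *)

(** It is enough to make the chains meet in one cell: the top of the column [0], which
    is within reach from every point of the base. *)
Definition meet_ind (x : X) : \bar R :=
  ((lab x == (0%N, (height 0%N).-1))%:R : R)%:E.

Lemma meet_ind_ge0 x : (0 <= meet_ind x)%E. Proof. by rewrite lee_fin. Qed.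

Definition meet_prob n x : R := fine (iter n back meet_ind x).

Lemma meet_prob_itv n x : (0 <= iter n back meet_ind x <= 1%:E)%E.
Proof.
apply/andP; split.
  by apply: iter_kernel_ge0 => //; [exact: wt_ge0|exact: meet_ind_ge0].
rewrite -[leRHS](iter_kernel_cst (wt := wt) br wt_ge0 wt_sum n x ler01).
apply: le_iter_kernel => [|y]; first exact: wt_ge0.
by rewrite lee_fin lern1 leq_b1.
Qed.

Lemma meet_probE n x : iter n back meet_ind x = (meet_prob n x)%:E.
Proof.
have /andP[ge0 le1] := meet_prob_itv n x.
by rewrite fineK// ge0_fin_numE// (le_lt_trans le1)// ltry.
Qed.

Lemma meet_prob_ge0 n x : 0 <= meet_prob n x.
Proof. by rewrite -lee_fin -meet_probE; case/andP: (meet_prob_itv n x). Qed.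

Lemma meet_prob_le1 n x : meet_prob n x <= 1.
Proof. by rewrite -lee_fin -meet_probE; case/andP: (meet_prob_itv n x). Qed.

(** By bounded distortion, the probability of a branch is comparable at all the
    points of the base. *)
Lemma wt_lower a : exists2 e, 0 < e & forall x, ht x = 0%N -> e <= wt x a.
Proof.
have C1 : 0 < 1 + C by rewrite ltr_wpDr ?distort_ge0.
exists (wt (base_pt S) a / (1 + C)).
  by rewrite divr_gt0// wt_gt0 ?lab_base_pt.
move=> x hx; rewrite ler_pdivrMr// mulrC.
apply: le_trans (wt_distort a (lab_base_pt S) hx) _.
by rewrite ler_wpM2r ?wt_ge0// lerD2l ler_piMr ?distort_ge0 ?dist_le1.
Qed.

Definition meet_unif n := exists2 e, 0 < e &
  forall x, ht x = 0%N -> e <= meet_prob n x.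

Lemma back_ge_br f x a : (forall x, 0 <= f x)%E ->
  ((wt x a)%:E * f (br x a) <= back f x)%E.
Proof.
move=> f0; apply: esum_ge; exists [set a]; first by split.
by rewrite fsbig_set1.
Qed.

Lemma iter_meet_ge0 n x : (0 <= iter n back meet_ind x)%E.
Proof. by case/andP: (meet_prob_itv n x). Qed.

Lemma meet_unif1 : meet_unif 1.
Proof.
have [e e0 eP] := wt_lower 0; exists e => // x hx.
rewrite -lee_fin -meet_probE.
apply: le_trans (back_ge_br x 0 meet_ind_ge0).
by rewrite /meet_ind lab_base// eqxx mule1 lee_fin eP.
Qed.

(** From the base, jump to the top of the column [a] and go down: this returns to the
    base after [height a] steps. *)
Lemma meet_unif_step n a : meet_unif n -> meet_unif (n + height a).
Proof.
move=> [e e0 eP]; have [e' e'0 e'P] := wt_lower a.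
exists (e' * e) => [|x hx]; first exact: mulr_gt0.
rewrite -lee_fin -meet_probE -(prednK (height_gt0 S a)) addnS iterS.
apply: le_trans (back_ge_br x a (@iter_meet_ge0 _)).
have [b [b0 _ bE]] := back_descend (br x a).
move: bE; rewrite lab_base//= => ->; last exact: meet_ind_ge0.
by rewrite meet_probE -EFinM lee_fin ler_pM ?(ltW e0) ?(ltW e'0) ?e'P ?eP.
Qed.

(** The durations [s] that can be inserted form an additive monoid containing all the
    heights, whose gcd is [1]. *)
Lemma meet_unif_eventually : exists n0, forall n, (n0 <= n)%N -> meet_unif n.
Proof.
pose G s := forall n, meet_unif n -> meet_unif (n + s).
have [||||n0 n0P] := @semigroup_eventually G.
- by move=> n; rewrite addn0.
- by move=> s t Gs Gt n /Gs /Gt; rewrite addnA.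
- exists (height 0%N); first exact: height_gt0.
  by move=> n; exact: meet_unif_step.
- move=> k kd; apply: (@height_gcd _ _ S) => a; apply: kd => n.
  exact: meet_unif_step.
exists n0.+1 => n nn0; rewrite (_ : n = (1 + n.-1)%N); last by lia.
by apply: n0P; [lia|exact: meet_unif1].
Qed.

(** A time which exceeds [H] by enough leaves a large number of steps after the
    descent from any height below [H]. *)
Lemma meet_unif_heights H : exists n, exists2 e, 0 < e &
  forall x, (ht x <= H)%N -> e <= meet_prob n x.
Proof.
have [n0 n0P] := meet_unif_eventually; exists (n0 + H)%N.
have : forall h, (h <= H)%N -> exists2 e, 0 < e &
    forall x, (H - h <= ht x <= H)%N -> e <= meet_prob (n0 + H) x.
  elim=> [_|h IH hH].
    have [e e0 eP] := n0P n0 (leqnn _); exists e => // x.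
    rewrite subn0 => /anti_leq hx; have [b [b0 _ bE]] := back_descend x.
    move: bE; rewrite -lee_fin -meet_probE -hx => ->; last exact: meet_ind_ge0.
    by rewrite meet_probE lee_fin eP.
  have [e e0 eP] := IH (ltnW hH).
  have [|e' e'0 e'P] := n0P (n0 + h.+1)%N; first exact: leq_addr.
  exists (Num.min e e') => [|x /andP[hx1 hx2]]; first by rewrite lt_min e0.
  rewrite ge_min; have [hx|hx] := leqP (H - h) (ht x).
    by rewrite eP ?hx.
  have {}hx : ht x = (H - h.+1)%N by lia.
  have [b [b0 _ bE]] := back_descend x.
  apply/orP; right; rewrite -lee_fin -meet_probE.
  rewrite (_ : n0 + H = n0 + h.+1 + ht x)%N; last by lia.
  by rewrite bE ?meet_probE ?lee_fin ?e'P//; exact: meet_ind_ge0.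
move=> /(_ H (leqnn _))[e e0 eP]; exists e => // x hx; apply: eP.
by rewrite subnn.
Qed.

End backward.

(** * Coupling two backward chains *)

Section coupled.
Variables (R : realType) (X : Type) (S : backward_tower R X).

Local Notation br := (br S).
Local Notation wt := (wt S).
Local Notation lab := (lab S).
Local Notation dist := (dist S).
Local Notation height := (height S).
Local Notation be := (rate S).
Local Notation C := (distort S).
Local Notation M := (moment S).
Local Notation ht x := (lab x).2.
Local Notation P := (back S).

Definition pair_wt (z : X * X) : nat * nat -> R :=
  if lab z.1 == lab z.2 then max_coupling (wt z.1) (wt z.2)
  else prod_coupling (wt z.1) (wt z.2).

Definition pair_br (z : X * X) (k : nat * nat) : X * X :=
  (br z.1 k.1, br z.2 k.2).

Definition pback := kernel_op pair_wt pair_br.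

Lemma pair_wtP z : coupling (wt z.1) (wt z.2) (pair_wt z).
Proof.
rewrite /pair_wt; case: ifP => _.
  by apply: max_couplingP; exact: wt_pweight.
by apply: prod_couplingP; exact: wt_pweight.
Qed.

Lemma pair_wt_ge0 z k : 0 <= pair_wt z k.
Proof. by have [] := pair_wtP z. Qed.

Lemma pair_wt_sum z : (\esum_(k in [set: nat * nat]) (pair_wt z k)%:E = 1)%E.
Proof. exact: coupling_sum (wt_pweight S z.1) (pair_wtP z). Qed.

Lemma pback_fst f z : (forall x, 0 <= f x)%E ->
  pback (fun z => f z.1) z = P f z.1.
Proof.
by move=> f0; have [_ /(_ (fun a => f (br z.1 a))) + _] := pair_wtP z; apply.
Qed.

Lemma pback_snd f z : (forall x, 0 <= f x)%E ->
  pback (fun z => f z.2) z = P f z.2.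
Proof.
by move=> f0; have [_ _ /(_ (fun a => f (br z.2 a)))] := pair_wtP z; apply.
Qed.

(** The purpose of the coupling: a modulus of continuity is transported by
    [pback] along the coupled chains. *)
Lemma back_modulus (f f' : X -> \bar R) (om : X * X -> \bar R) x x' :
  (forall y, 0 <= f y)%E -> (forall y, 0 <= f' y)%E -> (forall z, 0 <= om z)%E ->
  (forall a b, f (br x a) <= f' (br x' b) + om (br x a, br x' b))%E ->
  (P f x <= P f' x' + pback om (x, x'))%E.
Proof.
move=> f0 f'0 om0 H.
rewrite -(pback_fst (x, x') f0) -(pback_snd (x, x') f'0).
rewrite -kernelD//; last exact: pair_wt_ge0.
by apply: le_kernel_at => [|[a b]]; [exact: pair_wt_ge0|exact: H].
Qed.

(** Points of different cells are at distance [1]. *)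
Lemma dist_near_lab x y : dist x y < 1 -> lab x = lab y.
Proof.
move=> d1; apply/eqP; apply: contraTT d1 => xy.
by rewrite (dist_far xy) ltxx.
Qed.

Lemma lab_br_same x y a : lab x = lab y -> lab (br x a) = lab (br y a).
Proof.
move=> xy; have [hx|hx] := eqVneq (ht x) 0%N.
  by rewrite !lab_base// -xy.
by rewrite !lab_up -?xy.
Qed.

Lemma dist_br_same x y a : lab x = lab y ->
  dist (br x a) (br y a) = be * dist x y.
Proof. by move=> xy; rewrite dist_br//; exact: lab_br_same. Qed.

Lemma be_gt0 : 0 < be. Proof. by case/andP: (rate_itv S). Qed.
Lemma be_lt1 : be < 1. Proof. by case/andP: (rate_itv S). Qed.

(** Two points of a common cell fail to choose the same branch with a probability at
    most proportional to their distance. *)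
Lemma overlap_compl_le x y a : lab x = lab y ->
  wt x a - overlap (wt x) (wt y) a <= C * dist x y * wt y a.
Proof.
move=> xy; rewrite lerBlDr /overlap.
have CD : 0 <= C * dist x y by rewrite mulr_ge0 ?distort_ge0 ?dist_ge0.
have wy := wt_ge0 S y a.
have H : wt x a <= (1 + C * dist x y) * wt y a.
  have [hx|hx] := eqVneq (ht x) 0%N; first by rewrite wt_distort// -xy.
  by rewrite !wt_up -?xy// ler_peMl// lerDl.
rewrite minEle; case: ifP => _; first by rewrite lerDr mulr_ge0.
by rewrite (le_trans H)// mulrDl mul1r addrC.
Qed.

(** A lower bound of the probability that two points of a common cell choose the same
    branch. *)
Definition stick : R := (1 + C)^-1.

Lemma stick_itv : 0 < stick <= 1.
Proof.
have C0 := distort_ge0 S.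
by rewrite invr_gt0 invf_le1 ?ltr_wpDr//= lerDl.
Qed.

Lemma overlap_ge x y a : lab x = lab y ->
  stick * wt x a <= overlap (wt x) (wt y) a.
Proof.
move=> xy; have C0 := distort_ge0 S; have /andP[s0 s1] := stick_itv.
rewrite le_min; apply/andP; split; first by rewrite ler_piMl ?wt_ge0.
rewrite mulrC ler_pdivrMr ?ltr_wpDr// mulrC.
have := overlap_compl_le a xy; have := wt_ge0 S y a.
have [hx|hx] := eqVneq (ht x) 0%N.
  have hy : ht y = 0%N by rewrite -xy.
  move=> wy _; apply: le_trans (wt_distort a hx hy) _.
  by rewrite ler_wpM2r// lerD2l ler_piMr ?dist_le1.
by move=> wy _; rewrite !wt_up -?xy// ler_peMl// lerDl.
Qed.

(** ** Probability of becoming close *)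

Section near.
Variable L : nat.

Definition near_ind (z : X * X) : \bar R := ((dist z.1 z.2 <= be ^+ L)%R%:R : R)%:E.

Lemma near_ind_ge0 z : (0 <= near_ind z)%E. Proof. by rewrite lee_fin. Qed.

Lemma iter_near_ge0 k z : (0 <= iter k pback near_ind z)%E.
Proof.
by apply: iter_kernel_ge0; [exact: pair_wt_ge0|exact: near_ind_ge0].
Qed.

(** Together, the chains divide their distance at each step, until it is below the
    threshold. *)
Lemma stay_near k j z : lab z.1 = lab z.2 -> dist z.1 z.2 <= be ^+ j ->
  (L <= j + k)%N -> ((stick ^+ k)%:E <= iter k pback near_ind z)%E.
Proof.
have /andP[s0 _] := stick_itv.
have sk i : 0 <= stick ^+ i by rewrite exprn_ge0// ltW.
elim: k j z => [|k IH] j z zl dz jk.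
  rewrite expr0 /= /near_ind (le_trans dz)// ler_wiXn2l// ?ltW ?be_gt0 ?be_lt1//.
  by rewrite addn0 in jk.
have pw x := wt_pweight S x.
rewrite iterS {1}/pback /kernel_op /pair_wt zl eqxx max_couplingE//; last first.
  by move=> a; exact: iter_near_ge0.
rewrite -[leLHS]adde0; apply: leeD; last first.
  apply: esum_ge0 => a _; rewrite mule_ge0 ?lee_fin ?remainder_ge0//.
  exact: iter_near_ge0.
apply: (@le_trans _ _ (\esum_(a in [set: nat])
    ((stick ^+ k.+1)%:E * (wt z.1 a)%:E))%E).
  rewrite esumZl ?sk// ?wt_sum ?mule1// => a.
  by rewrite lee_fin wt_ge0.
apply: le_esum => a _; rewrite exprSr -EFinM -mulrA EFinM muleC.
apply: lee_pmul; rewrite ?lee_fin ?sk ?mulr_ge0 ?wt_ge0 ?overlap_ge//.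
  exact: ltW.
apply: (IH j.+1); rewrite /= ?(lab_br_same _ zl)//.
- by rewrite dist_br_same// exprS ler_wpM2l// ltW// be_gt0.
- by rewrite addSnnS.
Qed.

(** The chains run independently until they share a cell, and stay together
    afterwards with positive probability. *)
Lemma near_ge_meet n x y :
  ((stick ^+ (n + L) * (meet_prob S n x * meet_prob S n y))%:E <=
   iter (n + L) pback near_ind (x, y))%E.
Proof.
have /andP[s0 s1] := stick_itv.
have sk k : 0 <= stick ^+ k by rewrite exprn_ge0// ltW.
have m0 k u := meet_prob_ge0 S k u; have m1 k u := meet_prob_le1 S k u.
have same k u v : lab u = lab v ->
    ((stick ^+ (k + L) * (meet_prob S k u * meet_prob S k v))%:E <=
     iter (k + L) pback near_ind (u, v))%E.
  move=> uv; apply: (@le_trans _ _ (stick ^+ (k + L))%:E).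
    by rewrite lee_fin ler_piMr// mulr_ile1.
  by apply: (@stay_near _ 0) => //=; rewrite ?expr0 ?dist_le1// leq_addl.
elim: n x y => [|n IH] x y.
  have [xy|xy] := eqVneq (lab x) (lab y); first exact: same.
  suff -> : meet_prob S 0 x * meet_prob S 0 y = 0.
    by rewrite mulr0; exact: iter_near_ge0.
  rewrite /meet_prob /= /meet_ind /=; case: eqVneq => [lx|]; last by rewrite mul0r.
  by case: eqVneq => [ly|]; rewrite ?mulr0//; rewrite lx ly eqxx in xy.
have [xy|xy] := eqVneq (lab x) (lab y); first exact: same.
rewrite addSn iterS {1}/pback /kernel_op /pair_wt (negbTE xy).
apply: (@le_trans _ _ (\esum_(k in [set: nat * nat])
   ((prod_coupling (wt x) (wt y) k)%:E *
    (stick ^+ (n + L) * (meet_prob S n (br x k.1) * meet_prob S n (br y k.2)))%:E))%E);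
  last first.
  apply: le_esum => k _; rewrite lee_wpmul2l ?lee_fin ?mulr_ge0 ?wt_ge0//.
rewrite (esum_pair (f := fun a b => ((wt x a * wt y b)%:E * (stick ^+ (n + L) *
    (meet_prob S n (br x a) * meet_prob S n (br y b)))%:E)%E)); last first.
  by move=> a b; rewrite -EFinM lee_fin !mulr_ge0 ?wt_ge0.
have mS u : (\esum_(b in [set: nat]) (wt u b * meet_prob S n (br u b))%:E =
    (meet_prob S n.+1 u)%:E)%E.
  by rewrite -meet_probE; apply: eq_esum => b _; rewrite -/(iter n _ _) meet_probE.
rewrite (eq_esum (b := fun a => (stick ^+ (n + L) * meet_prob S n.+1 y)%:E *
    (wt x a * meet_prob S n (br x a))%:E)%E); last first.
  move=> a _; rewrite [in RHS]mulrC EFinM -mS.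
  rewrite (eq_esum (b := fun b => (stick ^+ (n + L) * (wt x a * meet_prob S n (br x a)))%:E *
    (wt y b * meet_prob S n (br y b))%:E)%E).
    rewrite esumZl ?mulr_ge0 ?wt_ge0//; last first.
      by move=> b; rewrite lee_fin mulr_ge0// wt_ge0.
    by rewrite mS -!EFinM; congr EFin; ring.
  by move=> b _; rewrite -!EFinM; congr EFin; ring.
rewrite esumZl ?mulr_ge0//; last by move=> b; rewrite lee_fin mulr_ge0// wt_ge0.
rewrite mS -EFinM lee_fin -mulrA [X in _ <= _ * X]mulrC ler_wpM2r ?mulr_ge0//.
by rewrite exprS ler_piMl.
Qed.

End near.
End coupled.

(** * Exponential mixing of the coupled chains *)

Lemma exprn_le_small (R : realType) (x e : R) : 0 <= x < 1 -> 0 < e ->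
  exists n : nat, x ^+ n <= e.
Proof.
move=> /andP[x0 x1] e0.
have : (x ^+ n @[n --> \oo] --> (0 : R))%classic by apply: cvg_expr; rewrite ger0_norm.
move=> /cvgr0_norm_le/(_ e e0)[n _ /(_ n (leqnn n))] /=.
by rewrite ger0_norm ?exprn_ge0//; exists n.
Qed.

Lemma exprn_1D_le (R : realType) (t : R) N : 0 <= t <= 1 ->
  (1 + t) ^+ N <= 1 + 2 ^+ N * t.
Proof.
move=> /andP[t0 t1].
suff : (1 + t) ^+ N <= 1 + (2 ^+ N - 1) * t.
  by move/le_trans; apply; rewrite lerD2l ler_wpM2r// gerBl.
elim: N => [|N IH]; first by rewrite !expr0 subrr mul0r addr0.
have t10 : 0 <= 1 + t by rewrite addr_ge0.
rewrite exprS (le_trans (ler_wpM2l t10 IH))// exprS.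
have k0 : 0 <= 2 ^+ N - 1 :> R by rewrite subr_ge0 exprn_ege1// ler1n.
have : (2 ^+ N - 1) * t * t <= (2 ^+ N - 1) * t by rewrite ler_piMr// mulr_ge0.
by move: (2 ^+ N) k0 => k k0; nra.
Qed.

Lemma bernoulli_ge (R : realType) (t : R) N : 0 <= t <= 1 ->
  1 - t *+ N <= (1 - t) ^+ N.
Proof.
move=> /andP[t0 t1]; elim: N => [|N IH]; first by rewrite mulr0n subr0.
have t10 : 0 <= 1 - t by rewrite subr_ge0.
rewrite exprS (le_trans _ (ler_wpM2l t10 IH))// mulrS.
have : 0 <= t * (t *+ N) by rewrite mulr_ge0// mulrn_wge0.
by move: (t *+ N) => u; nra.
Qed.

Section mixing.
Variables (R : realType) (X : Type) (S : backward_tower R X).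

Local Notation br := (br S).
Local Notation wt := (wt S).
Local Notation lab := (lab S).
Local Notation dist := (dist S).
Local Notation be := (rate S).
Local Notation C := (distort S).
Local Notation M := (moment S).
Local Notation ht x := (lab x).2.
Local Notation P := (back S).
Local Notation Q := (pback S).

Variable s : R.
Hypothesis s_itv : 0 < s <= tail S.

Local Notation V := (expht S s).
Local Notation ga := (expR (- s)).

Definition pair_ht (z : X * X) : R := V z.1 + V z.2.

Lemma pair_ht_ge2 z : 2 <= pair_ht z.
Proof. by rewrite (_ : 2 = 1 + 1)// lerD// expht_ge1. Qed.

Lemma moment_ge0 : 0 <= M. Proof. exact: le_trans ler01 (moment_ge1 S). Qed.

Lemma pback_pair_ht z : (Q (EFin \o pair_ht) z <= (ga * pair_ht z + 2 * M)%:E)%E.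
Proof.
have V0 x : (0 <= (V x)%:E)%E by rewrite lee_fin expht_ge0.
rewrite (_ : _ \o _ = fun z => (EFin (V z.1) + EFin (V z.2))%E)//.
rewrite /pback kernelD//; last exact: pair_wt_ge0.
rewrite [X in (X + _)%E](pback_fst S z V0) [X in (_ + X)%E](pback_snd S z V0).
apply: le_trans (leeD (back_expht s_itv z.1) (back_expht s_itv z.2)) _.
rewrite -EFinD lee_fin /pair_ht; lra.
Qed.

Definition drift_cst : R := 2 * M / (1 - ga).

Lemma drift_cst_ge0 : 0 <= drift_cst.
Proof.
have /andP[_ g1] := decay_itv s_itv.
by apply: divr_ge0; rewrite ?mulr_ge0 ?moment_ge0 ?subr_ge0// ltW.
Qed.

Lemma iter_pair_ht n z :
  (iter n Q (EFin \o pair_ht) z <= (ga ^+ n * pair_ht z + drift_cst)%:E)%E.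
Proof.
apply: iter_kernel_drift.
- exact: pair_wt_ge0.
- exact: pair_wt_sum.
- exact: decay_itv s_itv.
- by rewrite mulr_ge0 ?moment_ge0.
- by move=> y; rewrite (le_trans _ (pair_ht_ge2 y)).
- exact: pback_pair_ht.
Qed.

(** When two points of a common cell fail to choose the same branch, they land at
    heights which are controlled on average; the whole cost is proportional to
    their distance. *)
Lemma remainder_expht x y : lab x = lab y ->
  (\esum_(a in [set: nat]) ((wt x a - overlap (wt x) (wt y) a)%:E
     * (V (br x a))%:E) <= (C * M * dist x y)%:E)%E.
Proof.
move=> xy; have CD : 0 <= C * dist x y by rewrite mulr_ge0 ?distort_ge0 ?dist_ge0.
have [hx|hx] := eqVneq (ht x) 0%N; last first.
  rewrite esum1 ?lee_fin ?mulr_ge0 ?distort_ge0 ?dist_ge0 ?moment_ge0// => a _.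
  by rewrite /overlap !wt_up -?xy// minxx subrr mul0e.
apply: (@le_trans _ _ ((C * dist x y)%:E * P (EFin \o V) y)%E).
  rewrite /back /kernel_op -esumZl//; last first.
    by move=> a; rewrite mule_ge0// lee_fin ?wt_ge0 ?expht_ge0.
  apply: le_esum => a _; rewrite /= -!EFinM lee_fin /expht (lab_br_same a xy).
  by rewrite mulrA ler_wpM2r ?expR_ge0// overlap_compl_le.
have hy : ht y = 0%N by rewrite -xy.
rewrite (mulrAC C) [leRHS]EFinM lee_wpmul2l ?lee_fin//.
exact: back_expht_base.
Qed.

(** ** The contracted functional *)

(** [lyap] is the distance, rescaled, for close pairs, and for the others a
    small multiple of the exponential heights above a plateau at [1].  Close pairs
    get closer; distant pairs come down from great heights, or have a chance to
    become close when they are low. *)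
Section lyap.
Variables (L : nat) (k : R).
Hypothesis L_large : 4 * C * M * be ^+ L <= (1 - be) / 2.
Hypothesis k_itv : 0 < k <= 1 / 2.

Definition lyap (z : X * X) : R :=
  if dist z.1 z.2 <= be ^+ L.+1 then dist z.1 z.2 / be ^+ L
  else 1 + k * pair_ht z.

Let be0 : 0 < be. Proof. exact: be_gt0. Qed.
Let be1 : be < 1. Proof. exact: be_lt1. Qed.
Let beL0 : 0 < be ^+ L. Proof. by rewrite exprn_gt0. Qed.
Let k0 : 0 < k. Proof. by case/andP: k_itv. Qed.

Lemma lyap_farE z : be ^+ L.+1 < dist z.1 z.2 -> lyap z = 1 + k * pair_ht z.
Proof. by move=> d; rewrite /lyap ifN// -ltNge. Qed.

Lemma lyap_near_le z : dist z.1 z.2 <= be ^+ L.+1 -> lyap z <= be.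
Proof. by rewrite /lyap => d; rewrite d ler_pdivrMr// -exprS. Qed.

Lemma lyap_ge0 z : 0 <= lyap z.
Proof.
rewrite /lyap; case: ifP => _; first by rewrite divr_ge0 ?dist_ge0// ltW.
by rewrite addr_ge0// mulr_ge0 ?ltW// (lt_le_trans _ (pair_ht_ge2 z)).
Qed.

Lemma lyap_le z : lyap z <= 1 + k * pair_ht z.
Proof.
have [d|d] := leP (dist z.1 z.2) (be ^+ L.+1); last by rewrite lyap_farE.
rewrite (le_trans (lyap_near_le d))// (le_trans (ltW be1))// lerDl.
by rewrite mulr_ge0 ?ltW// (lt_le_trans _ (pair_ht_ge2 z)).
Qed.

Lemma lyap_le_pair_ht z : lyap z <= pair_ht z.
Proof.
rewrite (le_trans (lyap_le z))//; have /andP[_ k2] := k_itv.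
have := pair_ht_ge2 z; nra.
Qed.

Lemma dist_le_lyap z : dist z.1 z.2 <= lyap z.
Proof.
rewrite /lyap; case: ifP => _.
  by rewrite ler_peMr ?dist_ge0// invf_ge1// exprn_ile1// ltW.
rewrite (le_trans (dist_le1 _ _ _))// lerDl mulr_ge0 ?ltW//.
by rewrite (lt_le_trans _ (pair_ht_ge2 z)).
Qed.

(** If the two points choose the same branch the distance is multiplied by [be]; the
    other case costs at most a multiple of the distance, and this multiple is small
    after the rescaling because [be ^+ L] is small. *)
Lemma lyap_near z : dist z.1 z.2 <= be ^+ L.+1 ->
  (Q (EFin \o lyap) z <= ((1 + be) / 2 * lyap z)%:E)%E.
Proof.
case: z => x y /= d.
have xy : lab x = lab y.
  by apply: (@dist_near_lab _ _ S); rewrite (le_lt_trans d)// exprn_ilt1// ltW.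
have pw u := wt_pweight S u.
rewrite /pback /kernel_op /pair_wt /= xy eqxx max_couplingE//; last first.
  by move=> z; rewrite lee_fin lyap_ge0.
rewrite (_ : (1 + be) / 2 * lyap (x, y) =
  be * lyap (x, y) + (1 - be) / 2 * lyap (x, y)); last by field.
rewrite EFinD leeD//.
  apply: (@le_trans _ _ (\esum_(a in [set: nat])
      ((be * lyap (x, y))%:E * (wt x a)%:E))%E); last first.
    rewrite esumZl; first by rewrite wt_sum mule1.
    - by rewrite mulr_ge0 ?lyap_ge0 ?ltW.
    - by move=> a; rewrite lee_fin wt_ge0.
  apply: le_esum => a _; rewrite -!EFinM lee_fin.
  have -> : lyap (pair_br S (x, y) (a, a)) = be * lyap (x, y).
    rewrite /lyap /= d dist_br_same// ifT ?mulrA//.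
    by rewrite (le_trans _ d)// ler_piMl ?dist_ge0// ltW.
  rewrite mulrC ler_wpM2l//; first by rewrite mulr_ge0 ?lyap_ge0// ltW.
  by rewrite /overlap ge_min lexx.
apply: (@le_trans _ _ (\esum_(a in [set: nat * nat])
   ((remainder (wt x) (wt y) a)%:E * (2%:E * (V (br x a.1))%:E)
   + (remainder (wt x) (wt y) a)%:E * (2%:E * (V (br y a.2))%:E)))%E).
  apply: le_esum => a _; rewrite -ge0_muleDr; last 2 first.
  - by rewrite -EFinM lee_fin mulr_ge0 ?expht_ge0.
  - by rewrite -EFinM lee_fin mulr_ge0 ?expht_ge0.
  rewrite lee_wpmul2l ?lee_fin ?remainder_ge0// -mulrDr.
  rewrite (le_trans (lyap_le_pair_ht _))// /pair_ht ler_peMl ?addr_ge0 ?expht_ge0//.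
  by rewrite ler1n.
have E u v : lab u = lab v ->
  (\esum_(a in [set: nat * nat]) ((remainder (wt u) (wt v) a)%:E *
     (2%:E * (V (br u a.1))%:E)) <= (2 * C * M * dist u v)%:E)%E.
  move=> uv; rewrite (remainder_marginal (F := fun a => 2%:E * (V (br u a))%:E)%E)//.
    rewrite (eq_esum (b := fun a => 2%:E * ((wt u a - overlap (wt u) (wt v) a)%:E
        * (V (br u a))%:E))%E); last by move=> a _; rewrite muleCA.
    rewrite esumZl//; last first.
      by move=> a; rewrite mule_ge0 ?lee_fin ?expht_ge0// overlap_le.
    by rewrite -!mulrA EFinM lee_wpmul2l// mulrA; exact: remainder_expht.
  by move=> a; rewrite mule_ge0 ?lee_fin ?expht_ge0.
rewrite esumD; last 2 first.
- by move=> a _; rewrite !mule_ge0 ?lee_fin ?remainder_ge0 ?expht_ge0.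
- by move=> a _; rewrite !mule_ge0 ?lee_fin ?remainder_ge0 ?expht_ge0.
rewrite [X in (_ + X)%E]esum_pair_swap [X in (_ + X)%E](eq_esum (b := fun a =>
  (remainder (wt y) (wt x) a)%:E * (2%:E * (V (br y a.1))%:E))%E); last first.
  by move=> [a b] _; rewrite /= remainderC.
apply: le_trans (leeD (E _ _ xy) (E _ _ (esym xy))) _.
rewrite -EFinD lee_fin (dist_sym S y) /lyap/= d mulrA ler_pdivlMr//.
have := L_large; have := dist_ge0 S x y.
by move: (dist x y) (be ^+ L) => u v u0; nra.
Qed.

(** A crude bound, used for the steps that follow the first one: for a small weight
    [k] even many of these steps do not destroy the contraction gained before. *)
Lemma lyap_growth n z :
  (iter n Q (EFin \o lyap) z <= ((1 + 2 * M * k) ^+ n * lyap z)%:E)%E.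
Proof.
have M0 := moment_ge0; have k0' := k0.
have g0 : 0 <= 1 + 2 * M * k by rewrite addr_ge0// !mulr_ge0// ltW.
elim: n z => [|n IH] z; first by rewrite expr0 mul1r.
rewrite iterS; apply: le_trans (le_kernel (pair_br S) (@pair_wt_ge0 _ _ S) IH z) _.
rewrite (_ : (fun _ => _) =
   fun z => (((1 + 2 * M * k) ^+ n)%:E * (EFin \o lyap) z)%E)//.
rewrite kernelZ ?exprn_ge0//; last 2 first.
- exact: pair_wt_ge0.
- by move=> y; rewrite lee_fin lyap_ge0.
rewrite exprSr -[X in (_ <= X%:E)%E]mulrA [leRHS]EFinM.
rewrite lee_wpmul2l ?lee_fin ?exprn_ge0//.
have [d|d] := leP (dist z.1 z.2) (be ^+ L.+1).
  apply: le_trans (lyap_near d) _; rewrite lee_fin ler_wpM2r ?lyap_ge0//.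
  have : 0 <= 2 * M * k by rewrite !mulr_ge0// ltW.
  by have := be1; lra.
apply: (@le_trans _ _ (1 + k * (ga * pair_ht z + 2 * M))%:E); last first.
  rewrite lee_fin lyap_farE//; have := pair_ht_ge2 z.
  have /andP[g0' g1] := decay_itv s_itv.
  move=> h2; have h0 : 0 <= k * pair_ht z by rewrite mulr_ge0 ?ltW// (lt_le_trans _ h2).
  have : ga * (k * pair_ht z) <= k * pair_ht z by rewrite ler_piMl// ltW.
  have : 0 <= M * k * (k * pair_ht z) by rewrite mulr_ge0// mulr_ge0// ltW.
  by move: (pair_ht z) ga h0 => h g h0; lra.
apply: (@le_trans _ _ (Q (fun z => 1%:E + k%:E * (EFin \o pair_ht) z)%E z)).
  apply: le_kernel => [|y]; first exact: pair_wt_ge0.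
  by rewrite /= -EFinM -EFinD lee_fin lyap_le.
have w0 := @pair_wt_ge0 _ _ S.
have h0 y : (0 <= (pair_ht y)%:E)%E.
  by rewrite lee_fin (le_trans _ (pair_ht_ge2 y)).
have k0'' := ltW k0.
rewrite /pback kernelD//; last by move=> y; rewrite /= mule_ge0 ?h0 ?lee_fin.
rewrite kernel_cst//; last exact: pair_wt_sum.
rewrite kernelZ// EFinD leeD2l// EFinM lee_wpmul2l ?lee_fin//.
exact: pback_pair_ht.
Qed.

End lyap.
End mixing.

Section mixing_thm.
Variables (R : realType) (X : Type) (S : backward_tower R X).

Local Notation lab := (lab S).
Local Notation dist := (dist S).
Local Notation be := (rate S).
Local Notation C := (distort S).
Local Notation M := (moment S).
Local Notation ht x := (lab x).2.
Local Notation Q := (pback S).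

Variable s : R.
Hypothesis s_itv : 0 < s <= tail S.

Local Notation V := (expht S s).
Local Notation ga := (expR (- s)).
Local Notation U := (pair_ht S s).
Local Notation b := (drift_cst S s).

(** Pairs of bounded height become close with a probability bounded below, at a
    fixed time. *)
Lemma near_uniform L r : exists n, exists2 p : R, 0 < p & forall z, U z <= r ->
  (p%:E <= iter n.+1 Q (near_ind S L.+1) z)%E.
Proof.
have /andP[s0 _] := s_itv.
have [n [e e0 eP]] := meet_unif_heights S (Num.bound (r / s)).
exists (n + L)%N; exists (stick S ^+ (n + L.+1) * (e * e)).
  by have /andP[t0 _] := stick_itv S; rewrite !mulr_gt0 ?exprn_gt0.
have hH x : V x <= r -> e <= meet_prob S n x.
  move=> Vr; apply: eP; rewrite -(ler_nat R).
  have : (ht x)%:R <= r / s.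
    rewrite ler_pdivlMr// (le_trans _ Vr)// mulrC /expht.
    by rewrite (le_trans _ (expR_ge1Dx _))// lerDr.
  move/le_trans; apply; apply: ltW; apply: archi_boundP.
  by rewrite divr_ge0 ?(le_trans _ Vr) ?expht_ge0// ltW.
move=> [x y] Ur; rewrite -addnS; apply: le_trans (near_ge_meet S L.+1 n x y).
have t0 : 0 <= stick S ^+ (n + L.+1).
  by rewrite exprn_ge0// ltW//; case/andP: (stick_itv S).
have V0 u : 0 <= V u by exact: expht_ge0.
rewrite lee_fin ler_wpM2l// ler_pM ?(ltW e0)// hH//.
  by rewrite (le_trans _ Ur)// /pair_ht lerDl.
by rewrite (le_trans _ Ur)// /pair_ht lerDr.
Qed.

Lemma iter_affine_pair_ht N (k : R) z : 0 <= k ->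
  (iter N.+1 Q (fun z => 1%:E + k%:E * (EFin \o U) z) z <=
   (1 + k * (ga * U z + b))%:E)%E.
Proof.
move=> k0; have w0 := @pair_wt_ge0 _ _ S.
have [g0 g1] := andP (decay_itv s_itv).
have h0 y : 0 <= U y by rewrite (le_trans _ (pair_ht_ge2 s_itv y)).
rewrite iter_kernelD//; last by move=> y; rewrite mule_ge0 ?lee_fin//= h0.
rewrite iter_kernel_cst//; last exact: pair_wt_sum.
rewrite iter_kernelZ//.
rewrite EFinD leeD2l// EFinM lee_wpmul2l ?lee_fin//.
apply: le_trans (iter_pair_ht s_itv N.+1 z) _.
by rewrite lee_fin lerD2r ler_wpM2r// exprS ler_piMr// exprn_ile1// ltW.
Qed.

(** The contraction of [lyap] at a large time.  The parameters are chosen in this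
    order: the scale [L] of closeness, the height [r] beyond which the drift wins,
    the time [N.+1] and probability [p] of becoming close below [r], and the weight
    [k] of the heights. *)
Lemma lyap_contraction : exists L (k : R) N (rho : R),
  [/\ 0 < k <= 1 / 2, 0 < rho < 1 &
   forall z, (iter N.+1 Q (EFin \o lyap S s L k) z <= (rho * lyap S s L k z)%:E)%E].
Proof.
have [g0 g1] := andP (decay_itv s_itv).
have M1 := moment_ge1 S; have C0 := distort_ge0 S.
have be0 := be_gt0 S; have be1 := be_lt1 S.
have b0 : 0 <= b := drift_cst_ge0 s_itv.
have w0 := @pair_wt_ge0 _ _ S.
have CM0 : 0 <= C * M by rewrite mulr_ge0// (le_trans ler01).
have M0 : 0 < M by rewrite (lt_le_trans ltr01).
have [L LP] : exists L, be ^+ L <= (1 - be) / (8 * (C * M + 1)).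
  apply: exprn_le_small; first by rewrite be1 ltW.
  by rewrite divr_gt0 ?subr_gt0// mulr_gt0// ltr_wpDl.
have L_large : 4 * C * M * be ^+ L <= (1 - be) / 2.
  move: LP; rewrite ler_pdivlMr ?mulr_gt0 ?ltr_wpDl//.
  have : 0 <= be ^+ L by rewrite exprn_ge0// ltW.
  by rewrite -(mulrA 4); move: (be ^+ L) (C * M) CM0 => u v; nra.
pose r := 2 * (b + 1) / (1 - ga).
have r0 : 0 < r by rewrite divr_gt0 ?subr_gt0// mulr_gt0// ltr_wpDl.
have br : b <= (1 - ga) * r / 2.
  rewrite (_ : _ / 2 = b + 1) ?lerDl// /r.
  by field; rewrite gt_eqF// subr_gt0.
have [N [p p0 pP]] := near_uniform L r.
pose k1 := (1 - be) * p / (2 * (r + b)).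
pose k2 := (1 - be) / (8 * (2 ^+ N * M)).
pose k := Num.min (1 / 2) (Num.min k1 k2).
have N0 : 1 <= 2 ^+ N :> R by rewrite exprn_ege1// ler1n.
have NM : 0 < 2 ^+ N * M by rewrite mulr_gt0// (lt_le_trans ltr01).
have rb : 0 < r + b by rewrite ltr_wpDr.
have k0 : 0 < k.
  by rewrite !lt_min /k1 /k2 !divr_gt0 ?mulr_gt0 ?subr_gt0 ?exprn_gt0.
have kle1 : k <= 1 / 2 by rewrite ge_min lexx.
have kle2 : k * (r + b) <= (1 - be) * p / 2.
  have : k <= k1 by rewrite !ge_min lexx orbT.
  by rewrite /k1 ler_pdivlMr ?mulr_gt0//; lra.
have kle3 : 2 ^+ N * (2 * M * k) <= (1 - be) / 4.
  have : k <= k2 by rewrite !ge_min lexx !orbT.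
  rewrite /k2 ler_pdivlMr ?mulr_gt0 ?exprn_gt0//.
  by move: (2 ^+ N) => u; lra.
pose u0 := k * r.
have u0p : 0 < u0 by rewrite mulr_gt0.
pose de := u0 * (1 - ga) / (2 * (1 + u0)).
have u1p : 0 < 1 + u0 by rewrite addr_gt0.
have de0 : 0 < de by rewrite divr_gt0// mulr_gt0// subr_gt0.
pose rho := Num.max ((3 + be) / 4) (Num.max (1 - de) (1 - (1 - be) * p / 2)).
exists L; exists k; exists N; exists rho; split; first by rewrite k0.
  apply/andP; split; first by rewrite lt_max; apply/orP; left; lra.
  have : 0 < (1 - be) * p by rewrite mulr_gt0// subr_gt0.
  by rewrite !gt_max => ?; apply/and3P; split; lra.
have k_itv : 0 < k <= 1 / 2 by rewrite k0.
have W0 := lyap_ge0 s_itv L k_itv.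
have h0 y : 0 <= U y by rewrite (le_trans _ (pair_ht_ge2 s_itv y)).
(* Close pairs contract at the first step, and the later ones lose little. *)
move=> z; have [d|d] := leP (dist z.1 z.2) (be ^+ L.+1).
  rewrite iterS.
  have step := lyap_growth s_itv L_large k_itv N.
  apply: le_trans (le_kernel (pair_br S) w0 step z) _.
  have c0 : 0 <= 2 * M * k.
    by rewrite mulr_ge0 ?(ltW k0)// mulr_ge0// (le_trans ler01).
  rewrite (_ : (fun _ => _) =
   fun z => (((1 + 2 * M * k) ^+ N)%:E * (EFin \o lyap S s L k) z)%E)//.
  have e0 : 0 <= (1 + 2 * M * k) ^+ N by rewrite exprn_ge0// addr_ge0.
  rewrite kernelZ//.
  apply: (@le_trans _ _ (((1 + 2 * M * k) ^+ N)%:E *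
      ((1 + be) / 2 * lyap S s L k z)%:E)%E).
    by rewrite lee_wpmul2l ?lee_fin//; exact: lyap_near.
  rewrite lee_fin mulrA ler_wpM2r// /rho le_max; apply/orP; left.
  have c1 : 2 * M * k <= 1.
    have : 2 * M * k <= 2 ^+ N * (2 * M * k) by rewrite ler_peMl.
    by lra.
  have /(exprn_1D_le N) : 0 <= 2 * M * k <= 1 by rewrite c0.
  by move: ((1 + 2 * M * k) ^+ N) (2 ^+ N * (2 * M * k)) kle3 e0 => u v; nra.
have Wz : lyap S s L k z = 1 + k * U z by apply: lyap_farE.
(* Low pairs become close with probability [p], which brings [lyap] from [1] down
   to [be]. *)
have [Ur|Ur] := leP (U z) r.
  have {}pP := pP z Ur.
  have up := @le_iter_kernel _ _ _ _ (pair_br S) w0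
    (fun y => (EFin \o lyap S s L k) y + (1 - be)%:E * near_ind S L.+1 y)%E
    (fun y => 1%:E + k%:E * (EFin \o U) y)%E N.+1.
  have {}up y : (iter N.+1 Q (EFin \o lyap S s L k) y +
      (1 - be)%:E * iter N.+1 Q (near_ind S L.+1) y
      <= (1 + k * (ga * U y + b))%:E)%E.
    apply: le_trans (iter_affine_pair_ht N y (ltW k0)).
    apply: le_trans (up _ y).
      have be1' : 0 <= 1 - be by rewrite subr_ge0 ltW.
      have n0 x : (0 <= near_ind S L.+1 x)%E by exact: near_ind_ge0.
      rewrite iter_kernelD//; first by rewrite iter_kernelZ.
      by move=> x; rewrite mule_ge0 ?lee_fin.
    move=> x; rewrite /= -!EFinM -!EFinD lee_fin.
    have [dx|dx] := leP (dist x.1 x.2) (be ^+ L.+1).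
      rewrite mulr1; have := @lyap_near_le _ _ S s L k x dx.
      have : 0 <= k * U x by rewrite mulr_ge0// ltW.
      by lra.
    by rewrite mulr0 addr0 lyap_le.
  have {up} := up z.
  have : (((1 - be) * p)%:E <= (1 - be)%:E * iter N.+1 Q (near_ind S L.+1) z)%E.
    by rewrite EFinM lee_wpmul2l// lee_fin subr_ge0 ltW.
  move=> H1 H2; have {H1 H2} := le_trans (leeD2l _ H1) H2.
  rewrite -leeBrDr// -EFinB => /le_trans; apply.
  rewrite lee_fin (@le_trans _ _ (1 - (1 - be) * p / 2))//.
    have : k * (ga * U z + b) <= k * (r + b).
      rewrite ler_wpM2l ?(ltW k0)// lerD2r (le_trans _ Ur)// ler_piMl//.
      exact: ltW.
    by lra.
  have rho1 : 1 - (1 - be) * p / 2 <= rho by rewrite !le_max lexx !orbT.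
  have rhop : 0 <= rho by rewrite le_max; apply/orP; left; lra.
  by rewrite (le_trans rho1)// Wz ler_peMr// lerDl mulr_ge0// ltW.
(* For high pairs, the decrease of the heights dominates the plateau. *)
apply: le_trans (_ : _ <= (1 + k * (ga * U z + b))%:E)%E _.
  apply: le_trans (iter_affine_pair_ht N z (ltW k0)).
  apply: le_iter_kernel => // y.
  by rewrite -EFinM -EFinD lee_fin lyap_le.
rewrite lee_fin Wz (@le_trans _ _ ((1 - de) * (1 + k * U z)))//; last first.
  by rewrite ler_wpM2r ?addr_ge0 ?mulr_ge0 ?(ltW k0)// !le_max lexx !orbT.
have bU : b <= (1 - ga) * U z / 2.
  rewrite (le_trans br)// ler_wpM2r// ler_wpM2l ?subr_ge0 ?(ltW g1)//.
  exact: ltW.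
have kb : k * b <= (1 - ga) * (k * U z) / 2.
  apply: le_trans (ler_wpM2l (ltW k0) bU) _.
  by rewrite !mulrA (mulrC k).
have deE : de * (2 * (1 + u0)) = u0 * (1 - ga).
  by rewrite /de mulfVK// gt_eqF// mulr_gt0.
have uU : u0 <= k * U z by rewrite ler_wpM2l ?ltW.
suff : de * (1 + k * U z) <= k * U z * (1 - ga) / 2.
  have -> : k * (ga * U z + b) = ga * (k * U z) + k * b by ring.
  by move: (k * U z) (k * b) kb => v w; lra.
have u1 : 0 < 2 * (1 + u0) by rewrite mulr_gt0.
rewrite -(ler_pM2r u1) mulrAC deE.
move: (k * U z) uU => v uv.
have : u0 * (1 - ga) <= v * (1 - ga) by rewrite ler_wpM2r// subr_ge0 ltW.
by lra.
Qed.

(** The distance is below [lyap], which contracts along blocks of [N.+1] steps and is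
    itself below the exponential heights; Bernoulli's inequality converts the rate
    per block into a rate per step. *)
Theorem exponential_mixing : exists C1 rho : R, [/\ 0 < C1, 0 < rho < 1 &
  forall n z, (iter n Q (fun z => (dist z.1 z.2)%:E) z <=
    (C1 * rho ^+ n * pair_ht S s z)%:E)%E].
Proof.
have [L [k [N [rho [k_itv /andP[r0 r1] contr]]]]] := lyap_contraction.
have [g0 g1] := andP (decay_itv s_itv).
have b0 : 0 <= b := drift_cst_ge0 s_itv.
have w0 := @pair_wt_ge0 _ _ S.
have W0 := lyap_ge0 s_itv L k_itv.
have WE0 y : (0 <= (EFin \o lyap S s L k) y)%E by rewrite lee_fin W0.
pose t := (1 - rho) / N.+1%:R.
have N0 : 0 < N.+1%:R :> R by rewrite ltr0n.
have t_itv : 0 < t < 1.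
  rewrite divr_gt0 ?subr_gt0//= ltr_pdivrMr// mul1r.
  by rewrite (@lt_le_trans _ _ 1) ?ler1n//; lra.
have /andP[t0 t1] := t_itv.
have rt : rho <= (1 - t) ^+ N.+1.
  apply: le_trans (bernoulli_ge N.+1 (_ : 0 <= t <= 1)); last by rewrite !ltW.
  by rewrite /t -[X in _ - X]mulr_natr mulfVK ?gt_eqF// opprB addrC subrK.
have q0 : 0 < 1 - t by rewrite subr_gt0.
have mult j z : (iter (j * N.+1) Q (EFin \o lyap S s L k) z <=
    ((rho ^+ j)%:E * (EFin \o lyap S s L k) z))%E.
  elim: j z => [|j IH] z; first by rewrite mul0n expr0 mul1e.
  rewrite mulSn iterD.
  apply: le_trans (le_iter_kernel (pair_br S) w0 _ IH z) _.
  rewrite iter_kernelZ// ?exprn_ge0 ?(ltW r0)//.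
  rewrite exprSr EFinM -muleA lee_wpmul2l ?lee_fin ?exprn_ge0 ?(ltW r0)//.
exists ((1 + b) / (1 - t) ^+ N.+1); exists (1 - t); split.
- by rewrite divr_gt0 ?exprn_gt0// ltr_wpDr.
- by rewrite q0 /= gtrBl.
move=> n z; have nE := divn_eq n N.+1.
set j := (n %/ N.+1)%N in nE; set i := (n %% N.+1)%N in nE.
have iN : (i <= N.+1)%N by rewrite ltnW// ltn_pmod.
have d_le y : ((dist y.1 y.2)%:E <= (EFin \o lyap S s L k) y)%E.
  by rewrite lee_fin (dist_le_lyap s_itv L k_itv).
apply: le_trans (le_iter_kernel (pair_br S) w0 n d_le z) _.
rewrite nE addnC iterD.
apply: le_trans (le_iter_kernel (pair_br S) w0 _ (mult j) z) _.
rewrite iter_kernelZ// ?exprn_ge0 ?(ltW r0)//.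
apply: (@le_trans _ _ ((rho ^+ j)%:E * (pair_ht S s z + b)%:E)%E).
  rewrite lee_wpmul2l ?lee_fin ?exprn_ge0 ?(ltW r0)//.
  apply: (@le_trans _ _ (iter i Q (EFin \o U) z)).
    by apply: le_iter_kernel => // y; rewrite lee_fin lyap_le_pair_ht.
  apply: le_trans (iter_pair_ht s_itv i z) _.
  rewrite lee_fin lerD2r ler_piMl ?exprn_ile1 ?(ltW g1)//.
  by rewrite (le_trans _ (pair_ht_ge2 s_itv z)).
have U1 : 1 <= U z by rewrite (le_trans _ (pair_ht_ge2 s_itv z))// ler1n.
rewrite lee_fin; apply: (@le_trans _ _ (rho ^+ j * ((1 + b) * U z))).
  by rewrite ler_wpM2l ?exprn_ge0 ?(ltW r0)// mulrDl mul1r lerD2l ler_peMr.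
rewrite (_ : rho ^+ j * ((1 + b) * U z) = (1 + b) * (rho ^+ j * U z)); last by ring.
rewrite -[leRHS]mulrA -[leRHS]mulrA.
apply: ler_wpM2l; first by rewrite addr_ge0.
rewrite mulrA; apply: ler_wpM2r; first exact: le_trans ler01 U1.
rewrite ler_pdivlMl ?exprn_gt0//.
apply: (@le_trans _ _ ((1 - t) ^+ i * rho ^+ j)).
  rewrite ler_wpM2r ?exprn_ge0 ?(ltW r0)// ler_wiXn2l ?(ltW q0)//.
  by rewrite gerBl ltW.
rewrite exprD ler_wpM2l ?exprn_ge0 ?(ltW q0)// mulnC exprM.
by rewrite lerXn2r ?nnegrE ?exprn_ge0 ?(ltW r0) ?(ltW q0).
Qed.

End mixing_thm.

(** * Functionals of a trajectory *)

(** The linear term vanishes on average, so that only a quadratic term is left in the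
    conditional exponential moment. *)
Lemma expR_le_quad (R : realType) (t a : R) : `|t| <= a ->
  expR t <= 1 + t + a ^+ 2 * expR a.
Proof.
move=> ta; have a0 : 0 <= a by rewrite (le_trans _ ta).
have e1 : expR t <= 1 + t * expR t.
  have : (1 - t) * expR t <= expR (- t) * expR t.
    by rewrite ler_wpM2r ?expR_ge0// expR_ge1Dx.
  by rewrite -expRD addNr expR0; lra.
have ea : 1 <= expR a by rewrite -expR0 ler_expR.
have t2 : t ^+ 2 <= a ^+ 2 by rewrite -real_normK ?num_real// lerXn2r ?nnegrE.
have t20 : 0 <= t ^+ 2 by exact: sqr_ge0.
have [t0|t0] := leP 0 t.
  have et : expR t <= expR a by rewrite ler_expR (le_trans _ ta)// ler_norm.
  have : t ^+ 2 * expR t <= a ^+ 2 * expR a by rewrite ler_pM ?expR_ge0.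
  have : t * expR t <= t * (1 + t * expR t) by rewrite ler_wpM2l.
  by move: (expR t) (expR a) e1 => u v; lra.
have : t * expR t <= t * (1 + t) by rewrite ler_nM2l// expR_ge1Dx.
have : a ^+ 2 <= a ^+ 2 * expR a by rewrite ler_peMr// sqr_ge0.
by move: (expR t) (expR a) e1 => u v; lra.
Qed.

(** Cauchy-Schwarz for the weights [a]. *)
Lemma weighted_sum_sqr_le (R : realType) (a l : nat -> R) n :
  (forall i, 0 <= a i) ->
  (\sum_(i < n) a i * l i) ^+ 2 <=
  (\sum_(i < n) a i) * (\sum_(i < n) a i * l i ^+ 2).
Proof.
move=> a0; have cross m x : 2 * (\sum_(i < m) a i * l i) * x <=
    (\sum_(i < m) a i) * x ^+ 2 + \sum_(i < m) a i * l i ^+ 2.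
  rewrite mulr_suml -big_split/= mulr_sumr mulr_suml; apply: ler_sum => i _.
  rewrite -mulrDr mulrCA -mulrA ler_wpM2l//.
  by have := sqr_ge0 (x - l i); lra.
elim: n => [|n IH]; first by rewrite !big_ord0 mulr0 expr0n.
rewrite !big_ord_recr/=; move: IH (cross n (l n)) (a0 n).
move: (\sum_(i < n) a i) (\sum_(i < n) _) (\sum_(i < n) _) (a n) (l n).
by move=> t p q c x IH H c0; have := ler_wpM2l c0 H; lra.
Qed.

Lemma geometric_sum_le (R : realType) (r : R) n : 0 <= r < 1 ->
  \sum_(i < n) r ^+ i <= (1 - r)^-1.
Proof.
move=> /andP[r0 r1]; have r10 : 0 < 1 - r by rewrite subr_gt0.
rewrite -(ler_pM2l r10) mulfV ?gt_eqF//.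
rewrite -opprB mulNr -subrX1 opprB gerBl exprn_ge0//.
Qed.

Lemma kernel_sum (R : realType) (Z : Type) (I : choiceType) (wt : Z -> I -> R)
    (mv : Z -> I -> Z) (c : nat -> R) (f : nat -> Z -> \bar R) n z :
  (forall z i, 0 <= wt z i) -> (forall j, 0 <= c j) ->
  (forall j z, 0 <= f j z)%E ->
  kernel_op wt mv (fun z => \sum_(j < n) (c j)%:E * f j z)%E z =
  (\sum_(j < n) (c j)%:E * kernel_op wt mv (f j) z)%E.
Proof.
move=> w0 c0 f0; elim: n => [|n IH].
  rewrite big_ord0 /kernel_op esum1// => i _.
  by rewrite big_ord0 mule0.
rewrite big_ord_recr/= -IH -kernelZ// -kernelD//.
- by congr (kernel_op _ _ _ z); apply/funext => y; rewrite big_ord_recr.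
- by move=> y; apply: sume_ge0 => j _; rewrite mule_ge0 ?lee_fin.
- by move=> y; rewrite mule_ge0 ?lee_fin.
Qed.

Section trajectory.
Variables (R : realType) (X : Type) (S : backward_tower R X).

Local Notation br := (br S).
Local Notation wt := (wt S).
Local Notation lab := (lab S).
Local Notation dist := (dist S).
Local Notation height := (height S).
Local Notation M := (moment S).
Local Notation ht x := (lab x).2.
Local Notation P := (back S).
Local Notation Q := (pback S).

Definition scons (y : X) (xi : nat -> X) (i : nat) : X :=
  if i is j.+1 then xi j else y.

(** The conditional expectation of a functional of [y, xi 0, xi 1, ...] given
    [xi], when [y] is chosen among the preimages of [xi 0]. *)
Definition cond (f : (nat -> X) -> R) (xi : nat -> X) : R :=
  fine (P (fun y => (f (scons y xi))%:E) (xi 0%N)).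

Definition bounded_by (B : R) (f : (nat -> X) -> R) :=
  forall xi, 0 <= f xi <= B.

Definition seq_lipschitz (lip : nat -> R) (f : (nat -> X) -> R) :=
  forall i xi xi', (forall j, j != i -> xi j = xi' j) ->
    f xi <= f xi' + lip i * dist (xi i) (xi' i).

Lemma condE B f xi : bounded_by B f ->
  (cond f xi)%:E = P (fun y => (f (scons y xi))%:E) (xi 0%N).
Proof.
move=> fB; rewrite fineK// ge0_fin_numE.
  apply: le_lt_trans (ltry B).
  have B0 : 0 <= B by have /andP[f0 /(le_trans f0)] := fB xi.
  rewrite -[leRHS](kernel_cst br (wt_ge0 S) (wt_sum S) (xi 0%N) B0).
  apply: le_kernel => [|y]; first exact: wt_ge0.
  by rewrite lee_fin; case/andP: (fB (scons y xi)).
by apply: kernel_ge0 => [|y]; [exact: wt_ge0|rewrite lee_fin; case/andP: (fB (scons y xi))].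
Qed.

Lemma cond_bounded B f : bounded_by B f -> bounded_by B (cond f).
Proof.
move=> fB xi; have B0 : 0 <= B by have /andP[f0 /(le_trans f0)] := fB xi.
rewrite -!lee_fin (condE _ fB) kernel_ge0/=; last 2 first.
- exact: wt_ge0.
- by move=> y; rewrite lee_fin; case/andP: (fB (scons y xi)).
rewrite -[leRHS](kernel_cst br (wt_ge0 S) (wt_sum S) (xi 0%N) B0).
apply: le_kernel => [|y]; first exact: wt_ge0.
by rewrite lee_fin; case/andP: (fB (scons y xi)).
Qed.

Lemma iter_cond_bounded B f n : bounded_by B f -> bounded_by B (iter n cond f).
Proof. by move=> fB; elim: n => //= n IH; exact: cond_bounded. Qed.

Section modulus.
Variables (B : R) (f : (nat -> X) -> R) (lip : nat -> R).
Hypothesis f_bounded : bounded_by B f.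
Hypothesis f_lip : seq_lipschitz lip f.
Hypothesis lip_ge0 : forall i, 0 <= lip i.

Local Notation F n := (iter n cond f).
Local Notation D := (fun z : X * X => (dist z.1 z.2)%:E).

Let FB n : bounded_by B (F n). Proof. exact: iter_cond_bounded. Qed.
Let F0 n xi : (0 <= (F n xi)%:E)%E.
Proof. by rewrite lee_fin; case/andP: (FB n xi). Qed.
Let D0 z : (0 <= D z)%E. Proof. by rewrite lee_fin dist_ge0. Qed.

Lemma iter_dist_ge0 n z : (0 <= iter n Q D z)%E.
Proof. by apply: iter_kernel_ge0 => //; exact: pair_wt_ge0. Qed.

Lemma iter_dist_le1 n z : (iter n Q D z <= 1)%E.
Proof.
have w0 := @pair_wt_ge0 _ _ S.
rewrite -[leRHS](iter_kernel_cst (pair_br S) w0 (pair_wt_sum S) n z ler01).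
by apply: le_iter_kernel => // y; rewrite lee_fin dist_le1.
Qed.

(** The coordinates other than the first are not involved in the average, and keep
    their Lipschitz constants, shifted by the [n] coordinates averaged out. *)
Lemma iter_cond_lip n i xi xi' : (0 < i)%N -> (forall j, j != i -> xi j = xi' j) ->
  F n xi <= F n xi' + lip (n + i)%N * dist (xi i) (xi' i).
Proof.
elim: n i xi xi' => [|n IH] i xi xi' i0 E; first exact: f_lip.
have x0 : xi 0%N = xi' 0%N by apply: E; rewrite eq_sym -lt0n.
rewrite -lee_fin EFinD !iterS !(condE _ (FB n)) x0.
have l0 : 0 <= lip (n.+1 + i)%N * dist (xi i) (xi' i).
  by rewrite mulr_ge0 ?dist_ge0.
rewrite -(kernel_cst br (wt_ge0 S) (wt_sum S) (xi' 0%N) l0) -kernelD; last 3 first.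
- exact: wt_ge0.
- by move=> y; exact: F0.
- by move=> y; rewrite lee_fin.
apply: le_kernel => [|y]; first exact: wt_ge0.
rewrite -EFinD lee_fin addSnnS.
by apply: (IH i.+1 (scons y xi) (scons y xi')) => // -[|j] //= /E.
Qed.

(** The first coordinate, unlike the others, is the one on which the average over
    the past depends; its influence fades according to the coupling. *)
Lemma iter_cond_modulus n x x' xi :
  ((F n (scons x xi))%:E <= (F n (scons x' xi))%:E +
    \sum_(j < n.+1) (lip j)%:E * iter (n - j) Q D (x, x'))%E.
Proof.
elim: n x x' xi => [|n IH] x x' xi.
  rewrite big_ord1/= -EFinM -EFinD lee_fin.
  by apply: (f_lip (i := 0%N)) => -[|j].
pose om z := (\sum_(j < n.+1) (lip j)%:E * iter (n - j) Q D z)%E.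
have om0 z : (0 <= om z)%E.
  by apply: sume_ge0 => j _; rewrite mule_ge0 ?lee_fin ?iter_dist_ge0.
rewrite !iterS !(condE _ (FB n)) /=.
set l := lip n.+1 * dist x x'.
have l0 : 0 <= l by rewrite mulr_ge0 ?dist_ge0.
apply: le_trans (@back_modulus _ _ S _ _ (fun z => om z + l%:E)%E x x' _ _ _ _) _.
- by move=> y; exact: F0.
- by move=> y; exact: (F0 n (scons y (scons x' xi))).
- by move=> z; rewrite adde_ge0 ?lee_fin.
- move=> a b; rewrite addeA.
  have H : F n (scons (br x a) (scons x xi)) <=
      F n (scons (br x a) (scons x' xi)) + l.
    rewrite /l -(addn1 n).
    by apply: (iter_cond_lip n (i := 1)) => // -[|[|j]].
  apply: (@le_trans _ _ ((F n (scons (br x a) (scons x' xi)))%:E + l%:E)%E).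
    by rewrite -EFinD lee_fin.
  by rewrite leeD2r//; exact: IH.
rewrite leeD2l//.
have w0 := @pair_wt_ge0 _ _ S.
rewrite /pback kernelD//.
rewrite kernel_cst//; last exact: pair_wt_sum.
rewrite /om (kernel_sum _ _ (c := lip) (f := fun j => iter (n - j) Q D))//; last first.
  by move=> j z; exact: iter_dist_ge0.
rewrite [leRHS]big_ord_recr/= subnn /= EFinM leeD2r//.
by apply: lee_sum => j _; rewrite -iterS subSn// -ltnS.
Qed.

End modulus.
End trajectory.

(** * The conditional exponential moment *)

Section exp_step.
Variables (R : realType) (X : Type) (S : backward_tower R X).

Local Notation br := (br S).
Local Notation wt := (wt S).
Local Notation lab := (lab S).
Local Notation dist := (dist S).
Local Notation M := (moment S).
Local Notation ht x := (lab x).2.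
Local Notation P := (back S).
Local Notation Q := (pback S).

Variable s : R.
Hypothesis s_itv : 0 < s <= tail S.
Local Notation V := (expht S s).

Variables (C1 rho : R).
Hypothesis C1_gt0 : 0 < C1.
Hypothesis rho_itv : 0 < rho < 1.
Hypothesis mixing : forall n z,
  (iter n Q (fun z => (dist z.1 z.2)%:E) z <= (C1 * rho ^+ n * pair_ht S s z)%:E)%E.

(** A bound on the effect, [k] steps later, of changing the starting point [y] of
    the chain.  The distance never exceeds [1], whence the minimum. *)
Definition influence (k : nat) (y : X) : R :=
  Num.min 1 (C1 * (1 + M) * rho ^+ k * V y).

Definition pair_influence (k : nat) (z : X * X) : R :=
  Num.min 1 (C1 * rho ^+ k * pair_ht S s z).

Let C2 : R := C1 * (1 + M).
Let M0 : 0 <= M. Proof. exact: moment_ge0. Qed.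
Let C20 : 0 < C2. Proof. by rewrite mulr_gt0// ltr_wpDr. Qed.
Let rho0 : 0 < rho. Proof. by case/andP: rho_itv. Qed.
Let rho1 : rho < 1. Proof. by case/andP: rho_itv. Qed.
Let V1 y : 1 <= V y. Proof. exact: expht_ge1. Qed.
Let V0 y : 0 <= V y. Proof. exact: expht_ge0. Qed.
Let rk k : 0 <= rho ^+ k. Proof. by rewrite exprn_ge0// ltW. Qed.

Lemma influence_ge0 k y : 0 <= influence k y.
Proof. by rewrite le_min ler01 !mulr_ge0 ?addr_ge0// ltW. Qed.

Lemma pair_influence_ge0 k z : 0 <= pair_influence k z.
Proof. by rewrite le_min ler01 !mulr_ge0 ?addr_ge0// ltW. Qed.

(** One of the two points is integrated out: the mean of its exponential height is
    bounded, and is absorbed in the constant. *)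
Lemma back_pair_influence k x y : ht x = 0%N ->
  (P (fun y' => (pair_influence k (y, y'))%:E) x <= (influence k y)%:E)%E.
Proof.
move=> hx; rewrite /influence EFin_min le_min; apply/andP; split.
  rewrite -[leRHS](kernel_cst br (wt_ge0 S) (wt_sum S) x ler01).
  apply: le_kernel => [|z]; first exact: wt_ge0.
  by rewrite lee_fin ge_min lexx.
have c0 : 0 <= C1 * rho ^+ k by rewrite mulr_ge0// ltW.
have cV : 0 <= C1 * rho ^+ k * V y by rewrite mulr_ge0.
apply: (@le_trans _ _ (P (fun y' => (C1 * rho ^+ k * V y)%:E +
    (C1 * rho ^+ k)%:E * (EFin \o V) y')%E x)).
  apply: le_kernel => [|z]; first exact: wt_ge0.
  by rewrite /= -EFinM -EFinD lee_fin /pair_influence /pair_ht -mulrDr ge_min lexx orbT.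
rewrite /back kernelD; last 3 first.
- exact: wt_ge0.
- by move=> z; rewrite lee_fin.
- by move=> z; rewrite mule_ge0 ?lee_fin//= V0.
rewrite kernel_cst//; [|exact: wt_ge0|exact: wt_sum].
rewrite kernelZ//; [|exact: wt_ge0].
apply: (@le_trans _ _ ((C1 * rho ^+ k * V y)%:E + (C1 * rho ^+ k)%:E * M%:E)%E).
  by rewrite leeD2l// lee_wpmul2l ?lee_fin//; exact: back_expht_base.
rewrite -EFinM -EFinD lee_fin.
have : C1 * rho ^+ k * M <= C1 * rho ^+ k * (M * V y).
  by rewrite ler_wpM2l// ler_peMr.
rewrite (mulrAC C1 (1 + M)).
by move: (C1 * rho ^+ k) (V y) => u v; lra.
Qed.

Variables (B : R) (f : (nat -> X) -> R) (lip : nat -> R).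
Hypothesis f_bounded : bounded_by B f.
Hypothesis f_lip : seq_lipschitz S lip f.
Hypothesis lip_ge0 : forall i, 0 <= lip i.

Local Notation F n := (iter n (cond S) f).

Let FB n : bounded_by B (F n). Proof. exact: iter_cond_bounded. Qed.
Let F0 n xi : 0 <= F n xi. Proof. by case/andP: (FB n xi). Qed.

Definition total_influence n y := \sum_(j < n.+1) lip j * influence (n - j) y.

Lemma total_influence_ge0 n y : 0 <= total_influence n y.
Proof. by apply: sumr_ge0 => j _; rewrite mulr_ge0 ?influence_ge0. Qed.

Lemma iter_cond_osc n y y' xi :
  F n (scons y xi) <= F n (scons y' xi) +
    \sum_(j < n.+1) lip j * pair_influence (n - j) (y, y').
Proof.
rewrite -lee_fin EFinD.
apply: le_trans (iter_cond_modulus f_bounded f_lip lip_ge0 n y y' xi) _.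
rewrite leeD2l// -sumEFin; apply: lee_sum => j _.
rewrite EFinM lee_wpmul2l ?lee_fin// EFin_min le_min.
by rewrite iter_dist_le1 mixing.
Qed.

Lemma pair_influenceC k y y' : pair_influence k (y, y') = pair_influence k (y', y).
Proof. by rewrite /pair_influence /pair_ht /= addrC. Qed.

Lemma back_osc n x y : ht x = 0%N ->
  (P (fun y' => (\sum_(j < n.+1) lip j * pair_influence (n - j) (y, y'))%:E) x
   <= (total_influence n y)%:E)%E.
Proof.
move=> hx; rewrite (_ : (fun _ => _) = fun y' => (\sum_(j < n.+1)
    (lip j)%:E * (pair_influence (n - j) (y, y'))%:E)%E); last first.
  by apply/funext => y'; rewrite -sumEFin; apply: eq_bigr => j _; rewrite EFinM.
rewrite /back (kernel_sum _ _ (c := lip)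
  (f := fun j y' => (pair_influence (n - j) (y, y'))%:E))//; last 2 first.
- exact: wt_ge0.
- by move=> j z; rewrite lee_fin pair_influence_ge0.
rewrite /total_influence -sumEFin; apply: lee_sum => j _.
by rewrite EFinM lee_wpmul2l ?lee_fin// back_pair_influence.
Qed.

(** A deviation from the mean is at most the mean of the oscillations. *)
Lemma cond_deviation n y xi : ht (xi 0%N) = 0%N ->
  `|F n (scons y xi) - F n.+1 xi| <= total_influence n y.
Proof.
move=> hx; set x := xi 0%N in hx.
have w0 := wt_ge0 S; have w1 := wt_sum S.
have T0 := total_influence_ge0 n y.
pose om y' := \sum_(j < n.+1) lip j * pair_influence (n - j) (y, y').
have om0 y' : (0 <= (om y')%:E)%E.
  by rewrite lee_fin sumr_ge0// => j _; rewrite mulr_ge0 ?pair_influence_ge0.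
have FE : (F n.+1 xi)%:E = P (fun y => (F n (scons y xi))%:E) x.
  by rewrite iterS (condE S _ (FB n)).
rewrite ler_distl; apply/andP; split.
  rewrite lerBlDr -lee_fin FE.
  apply: (@le_trans _ _ (P (fun y' => (F n (scons y xi))%:E + (om y')%:E)%E x)).
    apply: le_kernel => // y'; rewrite -EFinD lee_fin.
    apply: le_trans (iter_cond_osc n y' y xi) _; rewrite lerD2l.
    by apply: ler_sum => j _; rewrite pair_influenceC.
  rewrite /back kernelD//; last by move=> z; rewrite lee_fin.
  by rewrite kernel_cst// EFinD leeD2l// back_osc.
rewrite -lee_fin EFinD FE -[leLHS](kernel_cst br w0 w1 x (F0 n _)).
apply: (@le_trans _ _ (P (fun y' => (F n (scons y' xi))%:E + (om y')%:E)%E x)).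
  by apply: le_kernel => // y'; rewrite -EFinD lee_fin iter_cond_osc.
rewrite /back kernelD//; last by move=> z; rewrite lee_fin.
by rewrite leeD2l// back_osc.
Qed.

(** A point of height [h] forgets its past only after about [h] steps, so its total
    influence grows linearly with [h], not exponentially. *)
Variable q : nat.
Hypothesis q_large : rho ^+ q * expR s <= 1.

Lemma influence_sum n y :
  \sum_(k < n) influence k y <= q%:R * (ht y)%:R + C2 / (1 - rho).
Proof.
pose N := (q * ht y)%N.
have rV : rho ^+ N * V y <= 1.
  rewrite /expht expRM_natr exprM -exprMn exprn_ile1//.
  by rewrite mulr_ge0 ?expR_ge0.
apply: (@le_trans _ _ (\sum_(0 <= k < N + n) influence k y)).
  rewrite (@big_cat_nat _ _ _ n)//= ?leq_addl// big_mkord lerDl.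
  by apply: sumr_ge0 => k _; exact: influence_ge0.
rewrite (@big_cat_nat _ _ _ N)//= ?leq_addr//; apply: lerD.
  rewrite big_mkord (@le_trans _ _ (\sum_(k < N) 1))//.
    by apply: ler_sum => k _; rewrite ge_min lexx.
  by rewrite sumr_const card_ord -natrM.
rewrite -{1}(add0n N) (addnC N n) big_addn addnK big_mkord.
apply: (@le_trans _ _ (\sum_(k < n) C2 * rho ^+ k)).
  apply: ler_sum => k _; rewrite ge_min; apply/orP; right.
  by rewrite exprD -!mulrA ler_wpM2l ?(ltW C1_gt0)// ler_wpM2l ?addr_ge0// ler_piMr.
rewrite -mulr_sumr ler_wpM2l ?(ltW C20)// geometric_sum_le//.
by rewrite rho1 ltW.
Qed.

Lemma rev_sum_influence n (g : nat -> R) :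
  \sum_(j < n.+1) g (n - j)%N = \sum_(k < n.+1) g k.
Proof.
rewrite [RHS](reindex_inj rev_ord_inj)/=.
by apply: eq_bigr => j _; rewrite subSS.
Qed.

Variable eps : R.
Hypothesis eps_gt0 : 0 < eps.
Hypothesis eps_small : 2 * eps * q%:R <= s.
Hypothesis s_small : 2 * s <= tail S.
Hypothesis lip_small : forall j, lip j <= eps.

Definition past_sqr n : R := \sum_(j < n.+1) lip j ^+ 2 * rho ^+ (n - j).

Definition exp_cst : R := C2 / eps * expR (2 * eps * (C2 / (1 - rho))).

Let b0 : 0 <= C2 / (1 - rho).
Proof. by rewrite divr_ge0 ?(ltW C20)// subr_ge0 ltW. Qed.

Lemma past_sqr_ge0 n : 0 <= past_sqr n.
Proof. by apply: sumr_ge0 => j _; rewrite mulr_ge0 ?sqr_ge0. Qed.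

Lemma exp_cst_ge0 : 0 <= exp_cst.
Proof. by rewrite mulr_ge0 ?expR_ge0// divr_ge0// ltW. Qed.

(** The total influence is at most [eps * u] with [u] affine in the height.  Its
    square is bounded by Cauchy-Schwarz, which makes the squares of the Lipschitz
    constants appear, and the remaining factor [u * expR (eps * u)] is at most
    [expR (2 * eps * u) / eps], an exponential of the height with a small rate. *)
Lemma total_influence_exp n y :
  total_influence n y ^+ 2 * expR (total_influence n y) <=
  exp_cst * past_sqr n * expht S (2 * s) y.
Proof.
set A := total_influence n y.
pose u := q%:R * (ht y)%:R + C2 / (1 - rho).
have u0 : 0 <= u by rewrite addr_ge0// mulr_ge0.
have A0 : 0 <= A by exact: total_influence_ge0.
have Iu : \sum_(j < n.+1) influence (n - j) y <= u.
  by rewrite (rev_sum_influence n (influence^~ y)) influence_sum.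
have Au : A <= eps * u.
  apply: le_trans (ler_wpM2l (ltW eps_gt0) Iu); rewrite mulr_sumr.
  by apply: ler_sum => j _; rewrite ler_wpM2r ?influence_ge0.
have A2 : A ^+ 2 <= u * (C2 * V y * past_sqr n).
  rewrite /A /total_influence (eq_bigr (fun j : 'I_n.+1 =>
    influence (n - j) y * lip j)); last by move=> j _; rewrite mulrC.
  apply: le_trans (weighted_sum_sqr_le (a := fun j => influence (n - j) y) lip n.+1 _) _.
    by move=> j; exact: influence_ge0.
  apply: ler_pM => //.
  - by apply: sumr_ge0 => j _; exact: influence_ge0.
  - by apply: sumr_ge0 => j _; rewrite mulr_ge0 ?influence_ge0 ?sqr_ge0.
  rewrite mulr_sumr; apply: ler_sum => j _.
  rewrite (_ : _ * (_ * _) = (C2 * rho ^+ (n - j) * V y) * lip j ^+ 2); last by ring.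
  by rewrite ler_wpM2r ?sqr_ge0// ge_min lexx orbT.
have ue : u <= eps^-1 * expR (eps * u).
  by rewrite ler_pdivlMl// (le_trans _ (expR_ge1Dx _))// lerDr.
have e2 : expR (eps * u) * expR (eps * u) <=
    expR (2 * eps * (C2 / (1 - rho))) * expR (s * (ht y)%:R).
  rewrite -!expRD ler_expR /u.
  have : 2 * eps * q%:R * (ht y)%:R <= s * (ht y)%:R by rewrite ler_wpM2r.
  by move: (C2 / (1 - rho)) (ht y)%:R => c h; lra.
have cV0 : 0 <= C2 * V y * past_sqr n.
  by rewrite mulr_ge0 ?past_sqr_ge0// mulr_ge0// ltW.
apply: (@le_trans _ _ (u * (C2 * V y * past_sqr n) * expR (eps * u))).
  by rewrite ler_pM ?sqr_ge0 ?expR_ge0// ler_expR.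
apply: (@le_trans _ _ (eps^-1 * expR (eps * u) * (C2 * V y * past_sqr n) *
    expR (eps * u))).
  by rewrite ler_wpM2r ?expR_ge0// ler_wpM2r.
rewrite (_ : _ * _ * _ * _ = eps^-1 * (C2 * V y * past_sqr n) *
    (expR (eps * u) * expR (eps * u))); last by ring.
apply: le_trans (ler_wpM2l _ e2) _.
  by rewrite mulr_ge0// invr_ge0 ltW.
rewrite /exp_cst /expht (_ : 2 * s * _ = s * (ht y)%:R + s * (ht y)%:R); last by ring.
rewrite expRD le_eqVlt; apply/orP; left; apply/eqP.
by move: (expR _) (expR _) => c v; ring.
Qed.

(** Above the base there is nothing to average; on the base, expand the exponential
    to the second order around the mean and use the moment of the heights. *)
Lemma exp_step n xi :
  (P (fun y => (expR (F n (scons y xi)))%:E) (xi 0%N) <=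
   (expR (F n.+1 xi + exp_cst * M * past_sqr n))%:E)%E.
Proof.
have w0 := wt_ge0 S; have w1 := wt_sum S.
have K0 : 0 <= exp_cst * M * past_sqr n.
  by rewrite mulr_ge0 ?past_sqr_ge0// mulr_ge0 ?exp_cst_ge0.
have FE : (F n.+1 xi)%:E = P (fun y => (F n (scons y xi))%:E) (xi 0%N).
  by rewrite iterS (condE S _ (FB n)).
set x := xi 0%N in FE *; have [hx|hx] := posnP (ht x); last first.
  have e0 y : (0 <= (expR (F n (scons y xi)))%:E)%E by rewrite lee_fin expR_ge0.
  have f0 y : (0 <= (F n (scons y xi))%:E)%E by rewrite lee_fin F0.
  have {}FE : F n.+1 xi = F n (scons (br x 0%N) xi).
    by apply: EFin_inj; rewrite FE (back_up hx f0).
  by rewrite (back_up hx e0) FE lee_fin ler_expR lerDl.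
set m := F n.+1 xi in FE *.
have m0 : 0 <= m by exact: (F0 n.+1).
pose E2 y := exp_cst * past_sqr n * expht S (2 * s) y.
have c0 : 0 <= exp_cst * past_sqr n by rewrite mulr_ge0 ?exp_cst_ge0 ?past_sqr_ge0.
have E20 y : 0 <= E2 y by rewrite mulr_ge0// expht_ge0.
have pt y : expR (F n (scons y xi) - m) + m <= 1 + F n (scons y xi) + E2 y.
  have := expR_le_quad (cond_deviation n y hx).
  by have := total_influence_exp n y; rewrite -/m /E2; lra.
have PE2 : (P (EFin \o E2) x <= (exp_cst * M * past_sqr n)%:E)%E.
  rewrite (_ : _ \o _ = fun y => ((exp_cst * past_sqr n)%:E *
    (EFin \o expht S (2 * s)) y)%E)//.
  rewrite /back kernelZ//; last by move=> y; rewrite lee_fin expht_ge0.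
  rewrite (mulrAC exp_cst M) [leRHS]EFinM lee_wpmul2l ?lee_fin//.
  apply: back_expht_base => //; rewrite s_small mulr_gt0//.
  by case/andP: s_itv.
have main : (P (fun y => (expR (F n (scons y xi) - m))%:E) x + m%:E <=
   (1 + exp_cst * M * past_sqr n)%:E + m%:E)%E.
  rewrite -[in leLHS](kernel_cst br w0 w1 x m0).
  rewrite -kernelD//.
  apply: (@le_trans _ _ (P (fun y => (1%:E + (F n (scons y xi))%:E) + (EFin \o E2) y)%E x)).
    by apply: le_kernel => // y; rewrite -!EFinD lee_fin.
  rewrite /back kernelD//; last by move=> y; rewrite -EFinD lee_fin addr_ge0.
  rewrite kernelD//; last by move=> y; rewrite lee_fin.
  rewrite kernel_cst// -/(P _ x) -FE addeAC leeD2r// EFinD leeD2l//.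
move: main; rewrite leeD2rE// => main.
rewrite (_ : (fun y => _) =
    fun y => ((expR m)%:E * (expR (F n (scons y xi) - m))%:E)%E); last first.
  by apply/funext => y; rewrite -EFinM -expRD addrC subrK.
rewrite /back kernelZ ?expR_ge0//.
rewrite expRD EFinM lee_wpmul2l ?lee_fin ?expR_ge0//.
by apply: le_trans main _; rewrite lee_fin expR_ge1Dx.
Qed.

End exp_step.

(** Exchange the sums and sum the geometric series. *)
Lemma past_sqr_sum_le (R : realType) (rho : R) (lip : nat -> R) n :
  0 < rho < 1 ->
  \sum_(p < n) past_sqr rho lip p <= (1 - rho)^-1 * \sum_(j < n) lip j ^+ 2.
Proof.
move=> /andP[r0 r1]; have r0' := ltW r0.
rewrite /past_sqr.
have -> : \sum_(p < n) \sum_(j < p.+1) lip j ^+ 2 * rho ^+ (p - j) =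
    \sum_(j < n) \sum_(i < n - j) lip j ^+ 2 * rho ^+ i.
  elim: n => [|n IH]; first by rewrite !big_ord0.
  rewrite big_ord_recr IH/= [RHS]big_ord_recr/= subSnn big_ord1 expr0.
  rewrite [X in _ + X = _]big_ord_recr/= subnn expr0 addrA; congr (_ + _).
  rewrite -big_split/=; apply: eq_bigr => j _.
  by rewrite subSn ?big_ord_recr// ltnW.
rewrite mulr_sumr; apply: ler_sum => j _; rewrite -mulr_sumr mulrC.
by rewrite ler_wpM2r ?sqr_ge0// geometric_sum_le// r0'.
Qed.

(** One backward step costs [K * past_sqr] in the exponential moment, and the
    dependence on the starting point of the chain disappears in the long run. *)
Theorem backward_concentration (R : realType) (X : Type)
    (S : backward_tower R X) :
  exists eps K rho : R, exists G : X -> X -> R,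
    [/\ 0 < eps, 0 <= K, 0 < rho < 1, forall x y, 0 <= G x y &
    forall B f lip, bounded_by B f -> seq_lipschitz S lip f ->
      (forall j, 0 <= lip j <= eps) -> forall n xi,
      (back S (fun y => (expR (iter n (cond S) f (scons y xi)))%:E) (xi 0%N) <=
        (expR (iter n.+1 (cond S) f xi + K * past_sqr rho lip n))%:E)%E /\
      forall y y', iter n (cond S) f (scons y xi) <=
        iter n (cond S) f (scons y' xi) +
        (\sum_(j < n.+1) lip j * rho ^+ (n - j)) * G y y'].
Proof.
pose s := tail S / 2.
have t0 := tail_gt0 S.
have s_itv : 0 < s <= tail S by rewrite /s; apply/andP; split; lra.
have s_small : 2 * s <= tail S by rewrite /s; lra.
have [C1 [rho [C10 rho_itv mix]]] := exponential_mixing s_itv.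
have /andP[r0 r1] := rho_itv.
have [q qP] : exists q, rho ^+ q <= expR (- s).
  by apply: exprn_le_small; rewrite ?expR_gt0// r1 ltW.
have {}qP : rho ^+ q * expR s <= 1.
  by rewrite -[leRHS]expR0 -(subrr s) addrC expRD ler_wpM2r// expR_ge0.
(* [q] steps offset one unit of height, and [eps] must make the linear growth of the
   total influence slower than half the exponential tail. *)
pose eps := s / (2 * (q%:R + 1)).
have q0 : 0 <= q%:R :> R by [].
have qq : 0 < 2 * (q%:R + 1) :> R by rewrite mulr_gt0// ltr_wpDl.
have eps0 : 0 < eps by apply: divr_gt0 => //; case/andP: s_itv.
have epsq : 2 * eps * q%:R <= s.
  have : eps * (2 * (q%:R + 1)) = s by rewrite /eps mulfVK// gt_eqF.
  by lra.
have M0 := moment_ge0 S.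
exists eps; exists (exp_cst S C1 rho eps * moment S); exists rho.
exists (fun y y' => C1 * pair_ht S s (y, y')); split => //.
- by rewrite mulr_ge0// exp_cst_ge0.
- move=> x y; rewrite mulr_ge0 ?(ltW C10)//.
  by rewrite (le_trans _ (pair_ht_ge2 s_itv (x, y))).
move=> B f lip fB fl lipP n xi.
have l0 j : 0 <= lip j by case/andP: (lipP j).
have le j : lip j <= eps by case/andP: (lipP j).
split; first exact: (exp_step s_itv C10 rho_itv mix fB fl l0 qP).
move=> y y'; apply: le_trans (iter_cond_osc mix fB fl l0 n y y' xi) _.
rewrite lerD2l mulr_suml; apply: ler_sum => j _; rewrite -mulrA ler_wpM2l//.
by rewrite /pair_influence ge_min mulrCA mulrA lexx orbT.
Qed.

(** * Combinatorics of a Young tower *)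

Section tower.
Variables (R : realType) (d : measure_display) (X : measurableType d).
Variables (T : X -> X) (mu : probability X R) (Y : uniform_young_tower T mu).

Local Notation cell := (cell Y).
Local Notation phi := (phi Y).
Local Notation beta := (beta Y).
Local Notation g := (inv_jac Y).
Local Notation dist := (tower_dist Y).
Local Notation base := (tower_base Y).

Lemma label_ex x : exists al : nat * nat, floors phi al /\ cell al.1 al.2 x.
Proof.
have [cov _ _] := cell_partition Y.
have : [set: X] x by [].
by rewrite -cov => -[al fal cx]; exists al.
Qed.

Definition label x : nat * nat := sval (cid (label_ex x)).

Lemma label_floor x : ((label x).2 < phi (label x).1)%N.
Proof. by rewrite /label; case: cid => al []. Qed.

Lemma label_cell x : cell (label x).1 (label x).2 x.
Proof. by rewrite /label; case: cid => al []. Qed.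

Lemma labelE x a l : (l < phi a)%N -> cell a l x -> label x = (a, l).
Proof.
move=> la cx; have [_ triv _] := cell_partition Y.
apply: triv; [exact: label_floor|exact: la|].
by exists x; split => //; exact: label_cell.
Qed.

Lemma same_cellE x y : same_cell cell phi x y <-> label x = label y.
Proof.
split=> [[[a l] [/= la cx cy]]|xy].
  by rewrite (labelE la cx) (labelE la cy).
exists (label x); split; [exact: label_floor|exact: label_cell|].
by rewrite xy; exact: label_cell.
Qed.

Lemma baseE x : base x <-> (label x).2 = 0%N.
Proof.
split=> [[a _ cx]|x0]; first by rewrite (labelE (phi_gt0 Y a) cx).
by exists (label x).1 => //; have := label_cell x; rewrite x0.
Qed.

Lemma label_step x : ((label x).2.+1 < phi (label x).1)%N ->
  label (T x) = ((label x).1, (label x).2.+1).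
Proof.
move=> lx; have [[fT _ _] _ _] := map_up lx.
by apply: labelE => //; apply: fT; exact: label_cell.
Qed.

Lemma label_top x : (label x).2 = (phi (label x).1).-1 -> (label (T x)).2 = 0%N.
Proof.
move=> lx; have [[fT _ _] _ _] := map_top Y (label x).1.
by apply/baseE; apply: fT; rewrite -lx; exact: label_cell.
Qed.

(** The labels of the preimages of [x] are read on the label of [x]. *)
Definition pre_label (x : X) (a : nat) : nat * nat :=
  if (label x).2 is l.+1 then ((label x).1, l) else (a, (phi a).-1).

Lemma label_preimage x y : T y = x -> label y = pre_label x (label y).1.
Proof.
move=> <-; rewrite /pre_label; have ly := label_floor y.
have [yl|yl] := ltnP (label y).2.+1 (phi (label y).1).
  by rewrite label_step//=; case: (label y).
have yt : (label y).2 = (phi (label y).1).-1.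
  by apply/eqP; rewrite eqn_leq -ltnS prednK ?phi_gt0// ly -ltnS prednK ?phi_gt0.
by rewrite label_top// -yt; case: (label y).
Qed.

Lemma step_inj y y' : T y = T y' -> label y = label y' -> y = y'.
Proof.
move=> Tyy yy; have ly := label_floor y.
have [yl|yl] := ltnP (label y).2.+1 (phi (label y).1).
  have [[_ iT _] _ _] := map_up yl.
  by apply: iT => //; rewrite inE; [exact: label_cell|rewrite yy; exact: label_cell].
have yt : (label y).2 = (phi (label y).1).-1.
  by apply/eqP; rewrite eqn_leq -ltnS prednK ?phi_gt0// ly -ltnS prednK ?phi_gt0.
have [[_ iT _] _ _] := map_top Y (label y).1.
by apply: iT => //; rewrite inE -yt; [exact: label_cell|rewrite yy; exact: label_cell].
Qed.

Lemma pre_ex x a : exists y, T y = x /\ label y = pre_label x a.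
Proof.
rewrite /pre_label; have lx := label_floor x; have cx := label_cell x.
case E : (label x).2 lx cx => [|l] lx cx.
  have [[_ _ sT] _ _] := map_top Y a.
  have [|y cy Ty] := sT x; first exact/baseE.
  exists y; split => //; apply: labelE => //.
  by rewrite prednK ?phi_gt0.
have [[_ _ sT] _ _] := map_up lx.
have [y cy Ty] := sT x cx.
by exists y; split => //; apply: labelE => //; exact: ltnW.
Qed.

Definition pre x a : X := sval (cid (pre_ex x a)).

Lemma preK x a : T (pre x a) = x.
Proof. by rewrite /pre; case: cid => y []. Qed.

Lemma label_pre x a : label (pre x a) = pre_label x a.
Proof. by rewrite /pre; case: cid => y []. Qed.

Lemma pre_uniq x a y : T y = x -> label y = pre_label x a -> pre x a = y.
Proof. by move=> Ty ly; apply: step_inj; rewrite ?preK ?label_pre. Qed.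

Lemma label_pre_up x a : (label x).2 != 0%N ->
  label (pre x a) = ((label x).1, (label x).2.-1).
Proof. by rewrite label_pre /pre_label; case: (label x).2. Qed.

Lemma label_pre_base x a : (label x).2 = 0%N -> label (pre x a) = (a, (phi a).-1).
Proof. by rewrite label_pre /pre_label => ->. Qed.

Lemma esum_preimage_base x (F : X -> \bar R) : (label x).2 = 0%N ->
  \esum_(y in T @^-1` [set x]) F y = \esum_(a in [set: nat]) F (pre x a).
Proof.
move=> lx; apply: reindex_esum; split.
- by move=> a _; exact: preK.
- move=> a b _ _ /(congr1 label); rewrite !label_pre_base//.
  by move=> [].
- move=> y Ty; exists (label y).1 => //; apply: pre_uniq => //.
  exact: label_preimage.
Qed.

Lemma esum_preimage_up x (F : X -> \bar R) : (label x).2 != 0%N ->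
  (forall y, 0 <= F y)%E ->
  \esum_(y in T @^-1` [set x]) F y = F (pre x 0%N).
Proof.
move=> lx F0; rewrite (_ : T @^-1` _ = [set pre x 0%N]) ?esum_set1//.
apply/seteqP; split=> y /= => [Ty|->]; last exact: preK.
apply/esym/pre_uniq => //; rewrite (label_preimage Ty) /pre_label.
by case: (label x).2 lx.
Qed.

(** ** The separation distance *)

Lemma sepP x y : match separation_time T cell phi x y with
  | Some n => label (iter n T x) <> label (iter n T y) /\
      forall m, (m < n)%N -> label (iter m T x) = label (iter m T y)
  | None => forall m, label (iter m T x) = label (iter m T y)
  end.
Proof.
rewrite /separation_time; case: pselect => [ex|nex].
  case: ex_minnP => n /asboolP nn nmin; split=> [nE|m mn].
    by apply: nn; apply/same_cellE.
  apply: contrapT => ne; have : (n <= m)%N.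
    by apply: nmin; apply/asboolP => /same_cellE.
  by rewrite leqNgt mn.
move=> m; apply: contrapT => ne; apply: nex; exists m; apply/asboolP.
by move/same_cellE.
Qed.

Lemma beta_gt0 : 0 < beta. Proof. by case/andP: (beta_itv Y). Qed.
Lemma beta_lt1 : beta < 1. Proof. by case/andP: (beta_itv Y). Qed.

Lemma tower_dist_ge0 x y : 0 <= dist x y.
Proof.
rewrite /tower_dist /separation_dist; case: separation_time => // n.
by rewrite exprn_ge0// ltW// beta_gt0.
Qed.

Lemma tower_dist_le1 x y : dist x y <= 1.
Proof.
rewrite /tower_dist /separation_dist; case: separation_time => // n.
by rewrite exprn_ile1// ltW ?beta_gt0 ?beta_lt1.
Qed.

Lemma sep_uniq x y n : label (iter n T x) <> label (iter n T y) ->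
  (forall m, (m < n)%N -> label (iter m T x) = label (iter m T y)) ->
  separation_time T cell phi x y = Some n.
Proof.
move=> ne lt; have := sepP x y; case: separation_time => [m [mne mlt]|/(_ n)//].
by case: (ltngtP m n) => [/lt|/mlt|->].
Qed.

Lemma tower_dist_sym x y : dist x y = dist y x.
Proof.
rewrite /tower_dist /separation_dist; have := sepP x y.
case E : separation_time => [n|].
  move=> [ne lt]; rewrite (@sep_uniq y x n)//; first exact: nesym.
  by move=> m /lt.
move=> all; have := sepP y x; case: separation_time => // n [+ _].
by rewrite all.
Qed.

Lemma tower_distxx x : dist x x = 0.
Proof.
rewrite /tower_dist /separation_dist; have := sepP x x.
by case: separation_time => // n [].
Qed.

Lemma tower_dist_far x y : label x != label y -> dist x y = 1.
Proof.
move=> /eqP xy; rewrite /tower_dist /separation_dist.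
by rewrite (@sep_uniq x y 0%N).
Qed.

Lemma tower_dist_step x y : label x = label y -> dist x y = beta * dist (T x) (T y).
Proof.
move=> xy; rewrite /tower_dist /separation_dist; have := sepP (T x) (T y).
case: separation_time => [n [ne lt]|all].
  rewrite (@sep_uniq x y n.+1) ?exprS ?iterSr// => -[//|m].
  by rewrite !iterSr ltnS; exact: lt.
rewrite mulr0; have := sepP x y; case: separation_time => // -[[]//|n [+ _]].
by rewrite !iterSr all.
Qed.

(** ** Measurability *)

Lemma measurable_label (D : set (nat * nat)) : measurable (label @^-1` D).
Proof.
rewrite (_ : _ @^-1` _ = \bigcup_(al in D `&` floors phi) cell al.1 al.2).
  rewrite bigcup_mkcond; apply: countable_bigcupT_measurable => // al.
  by case: ifPn => // /[!inE] -[_ la]; exact: cell_measurable.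
apply/seteqP; split=> x /=.
  move=> Dx; exists (label x); last exact: label_cell.
  by split => //; exact: label_floor.
by move=> [[a l] [Dal la] cx]; rewrite (labelE la cx).
Qed.

Lemma measurable_fun_label d' (Z : measurableType d') (h : nat * nat -> Z) :
  measurable_fun [set: X] (h \o label).
Proof.
by move=> _ B mB; rewrite setTI comp_preimage; exact: measurable_label.
Qed.

Lemma measurable_fun_cells d' (Z : measurableType d') (f : X -> Z) :
  (forall a l, (l < phi a)%N -> measurable_fun (cell a l) f) ->
  measurable_fun [set: X] f.
Proof.
move=> mf _ B mB; rewrite setTI.
rewrite (_ : _ @^-1` _ = \bigcup_(al in floors phi) (cell al.1 al.2 `&` f @^-1` B)).
  rewrite bigcup_mkcond; apply: countable_bigcupT_measurable => // al.
  case: ifPn => // /[!inE] la; apply: mf => //; exact: cell_measurable.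
apply/seteqP; split=> x /=; last by move=> [al _ []].
by move=> Bx; exists (label x); [exact: label_floor|split => //; exact: label_cell].
Qed.

Lemma measurable_step : measurable_fun [set: X] T.
Proof.
apply: measurable_fun_cells => a l la.
have [al|al] := ltnP l.+1 (phi a); first by have [] := map_up al.
rewrite (_ : l = (phi a).-1); first by have [] := map_top Y a.
by apply/eqP; rewrite eqn_leq -ltnS prednK ?phi_gt0// la -ltnS prednK ?phi_gt0.
Qed.

Lemma measurable_iter_step n : measurable_fun [set: X] (iter n T).
Proof.
elim: n => [|n IH]; first exact: measurable_id.
by apply: (measurableT_comp measurable_step IH).
Qed.

(** Images of measurable parts of a cell are measurable, so each branch of the
    inverse of [T] is measurable. *)
Lemma measurable_pre a : measurable_fun [set: X] (pre^~ a).
Proof.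
move=> _ E mE; rewrite setTI.
rewrite (_ : _ @^-1` _ = (T @` (cell a (phi a).-1 `&` E)) `|`
  \bigcup_(al in [set al : nat * nat | (al.2.+1 < phi al.1)%N])
     T @` (cell al.1 al.2 `&` E)).
  apply: measurableU.
    have [_ _ imT] := map_top Y a; apply: imT; first exact: subIsetl.
    by apply: measurableI => //; apply: cell_measurable; rewrite prednK ?phi_gt0.
  rewrite bigcup_mkcond; apply: countable_bigcupT_measurable => // al.
  case: ifPn => // /[!inE] /= la; have [_ _ imT] := map_up la.
  apply: imT; first exact: subIsetl.
  by apply: measurableI => //; apply: cell_measurable; exact: ltnW.
apply/seteqP; split=> x /=.
  move=> Ex; have lx := label_floor x; have ly := label_pre x a.
  have cy := label_cell (pre x a); rewrite ly /pre_label in cy.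
  case E0 : (label x).2 lx cy => [|l] lx cy.
    by left; exists (pre x a); [split|exact: preK].
  by right; exists ((label x).1, l) => //; exists (pre x a); [split|exact: preK].
case=> [[y [cy Ey] <-]|[[b l] /= bl [y [cy Ey] <-]]].
  have lab : label y = (a, (phi a).-1).
    by apply: labelE => //; rewrite prednK ?phi_gt0.
  rewrite (@pre_uniq _ a y)// (label_preimage (erefl (T y))) lab.
  by [].
have lab : label y = (b, l) by apply: labelE => //; exact: ltnW.
rewrite (@pre_uniq _ a y)// /pre_label.
by rewrite label_step lab.
Qed.

End tower.

(** * The invariant measure and the backward chain *)

Section tower_measure.
Variables (R : realType) (d : measure_display) (X : measurableType d).
Variables (T : X -> X) (mu : probability X R) (Y : uniform_young_tower T mu).

Local Notation cell := (cell Y).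
Local Notation phi := (phi Y).
Local Notation beta := (beta Y).
Local Notation g := (inv_jac Y).
Local Notation dist := (tower_dist Y).
Local Notation base := (tower_base Y).
Local Notation label := (label Y).
Local Notation pre := (pre Y).

Lemma measurable_floor a l : (l < phi a)%N -> measurable (cell a l).
Proof. by move=> la; exact: cell_measurable. Qed.

Lemma base_preimage : base = label @^-1` [set al | al.2 = 0%N].
Proof. by apply/seteqP; split=> x /baseE. Qed.

Lemma measurable_base : measurable base.
Proof. by rewrite base_preimage; exact: measurable_label. Qed.

(** Each floor is the full preimage of the next one. *)
Lemma mu_floor a l : (l < phi a)%N -> mu (cell a l) = mu (cell a 0%N).
Proof.
elim: l => // l IH la; rewrite -IH; last exact: ltnW.
rewrite -(mu_invariant Y (measurable_floor la)); congr (mu _).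
apply/seteqP; split=> y /= => [cTy|cy].
  have lTy := labelE la cTy; have ly := label_preimage Y (erefl (T y)).
  have := label_cell Y y; rewrite ly /pre_label lTy/=.
  by [].
have ly := labelE (ltnW la) cy.
have := label_cell Y (T y); rewrite label_step ly//.
Qed.

(** Otherwise all the floors would be null. *)
Lemma mu_base_gt0 : (0 < mu base)%E.
Proof.
rewrite lt0e measure_ge0 andbT; apply/eqP => base0.
have c0 a l : (l < phi a)%N -> mu (cell a l) = 0%E.
  move=> la; rewrite mu_floor//; apply/eqP; rewrite eq_le measure_ge0 andbT -base0.
  apply: le_measure; rewrite ?inE.
  - by apply: measurable_floor; exact: phi_gt0.
  - exact: measurable_base.
  - by move=> x cx; exists a.
pose F a l := if (l < phi a)%N then cell a l else set0.
have : mu.-negligible (\bigcup_a \bigcup_l F a l).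
  apply: negligible_bigcup => a; apply: negligible_bigcup => l.
  rewrite /F; case: ifPn => la; last exact: negligible_set0.
  apply/negligibleP; first exact: measurable_floor.
  exact: c0.
rewrite (_ : \bigcup_a _ = [set: X]); last first.
  apply/seteqP; split=> x // _; exists (label x).1 => //.
  by exists (label x).2 => //; rewrite /F label_floor; exact: label_cell.
move/(negligibleP _ measurableT) => m0; have := probability_setT mu.
by rewrite [LHS]m0 => /esym/eqP; rewrite onee_eq0.
Qed.

Lemma measurable_esum_preimage (k : X -> R) : measurable_fun [set: X] k ->
  (forall x, 0 <= k x) ->
  measurable_fun [set: X] (fun x => \esum_(y in T @^-1` [set x]) (k y)%:E : \bar R).
Proof.
move=> mk k0; rewrite (_ : (fun _ => _) = fun x => if (label x).2 == 0%N
    then (\sum_(a <oo) (k (pre x a))%:E)%E else (k (pre x 0%N))%:E); last first.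
  apply/funext => x; case: eqP => lx.
    rewrite (@esum_preimage_base _ _ _ _ _ Y)// nneseries_esumT// => a.
    by rewrite lee_fin.
  by rewrite (@esum_preimage_up _ _ _ _ _ Y)//; exact/eqP.
have mkp a : measurable_fun [set: X] (fun x => (k (pre x a))%:E).
  by apply/measurable_EFinP; apply: (measurableT_comp mk (measurable_pre Y a)).
apply: measurable_fun_ifT => //.
  exact: (measurable_fun_label Y (fun al => al.2 == 0%N)).
rewrite (_ : (fun _ => _) = fun x => (\sum_(a <oo | a \in xpredT) (k (pre x a))%:E)%E).
  by apply: ge0_emeasurable_sum => // a x _ _; rewrite lee_fin.
by apply/funext => x; apply: eq_eseriesl => a.
Qed.

(** ** Normalisation of the jacobian *)

Section weights.
Variable c0 : R.
Hypothesis c0_gt0 : 0 < c0.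
Hypothesis tails : (\int[mu]_(x in base) (expR (c0 * (return_time Y x)%:R))%:E
  < +oo)%E.

Lemma return_timeE x : base x -> return_time Y x = phi (label x).1.
Proof.
move=> bx; rewrite /return_time; have [a _ cx] := bx.
have -> : [set phi a | a in [set a | cell a 0%N x]] = [set phi (label x).1].
  apply/seteqP; split=> n /=.
    by move=> [b cb <-]; rewrite (labelE (phi_gt0 Y b) cb).
  move=> ->; exists (label x).1 => //=; have := label_cell Y x.
  by move/baseE : bx => ->.
by apply: xget_subset1 => //; move=> ? ? -> ->.
Qed.

Lemma base_tail_sum :
  (\sum_(a <oo) ((expR (c0 * (phi a)%:R))%:E * mu (cell a 0%N)) < +oo)%E.
Proof.
apply: le_lt_trans tails.
pose h (al : nat * nat) : R := expR (c0 * (phi al.1)%:R).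
have mf : measurable_fun base (fun x => (expR (c0 * (return_time Y x)%:R))%:E).
  apply: (eq_measurable_fun (EFin \o (h \o label))).
    by move=> x; rewrite inE => bx; rewrite /= /h return_timeE.
  apply: (@measurable_funS _ _ _ _ setT) => //.
  by apply/measurable_EFinP; exact: (measurable_fun_label Y h).
rewrite ge0_integral_bigcup//.
- apply: lee_nneseries => [a _ _|a _].
    by rewrite mule_ge0 ?lee_fin ?expR_ge0.
  have ma : measurable (cell a 0%N) by apply: measurable_floor; exact: phi_gt0.
  rewrite -integral_cst//; apply: ge0_le_integral => //.
  + by move=> x _; rewrite lee_fin expR_ge0.
  + apply: measurable_funS mf; first exact: measurable_base.
    by move=> x cx; exists a.
  + move=> x cx; rewrite return_timeE; last by exists a.
    by rewrite (labelE (phi_gt0 Y a) cx).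
- by move=> a; apply: measurable_floor; exact: phi_gt0.
- move=> a b _ _ [x [ca cb]].
  by have := labelE (phi_gt0 Y a) ca; rewrite (labelE (phi_gt0 Y b) cb) => -[].
Qed.

Definition preimage_moment (x : X) : \bar R :=
  (\esum_(a in [set: nat]) (g (pre x a) * expR (c0 * (phi a).-1%:R))%:E)%E.

Let g0 x : 0 < g x := inv_jac_gt0 Y x.

(** The integral of this moment over the base is a sum over the tops of the
    columns, which the exponential tails make finite. *)
Lemma preimage_moment_finite : exists x, (label x).2 = 0%N /\
  (preimage_moment x < +oo)%E.
Proof.
apply: contrapT => none.
have inf x : (label x).2 = 0%N -> preimage_moment x = +oo%E.
  move=> lx; apply: contrapT => fin; apply: none; exists x; split => //.
  by rewrite ltey; apply/eqP.
pose h (al : nat * nat) : R :=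
  if al.2 == (phi al.1).-1 then expR (c0 * (phi al.1).-1%:R) else 0.
have h0 al : 0 <= h al by rewrite /h; case: ifP => // _; exact: expR_ge0.
have mh : measurable_fun [set: X] (h \o label) by exact: measurable_fun_label.
have := inv_jacE Y mh (measurable_cst (1 : R)) (fun x => h0 _) (fun=> ler01).
apply/eqP; rewrite lt_eqF//.
apply: (@lt_le_trans _ _ +oo%E).
  pose k a x := ((expR (c0 * (phi a).-1%:R))%:E * (\1_(cell a (phi a).-1) x)%:E)%E.
  have top a : ((phi a).-1 < phi a)%N by rewrite prednK ?phi_gt0.
  have mk a : measurable_fun [set: X] (k a).
    apply: emeasurable_funM => //; apply/measurable_EFinP.
    by apply: measurable_indic; exact: measurable_floor.
  have k0 a x : (0 <= k a x)%E by rewrite mule_ge0 ?lee_fin ?expR_ge0.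
  apply: le_lt_trans base_tail_sum.
  apply: (@le_trans _ _ (\int[mu]_x (\sum_(a <oo) k a x)%E)%E).
    apply: ge0_le_integral => //.
    - by move=> x _; rewrite lee_fin /= mulr1 h0.
    - by apply/measurable_EFinP; apply: measurable_funM.
    - by apply: ge0_emeasurable_sum.
    move=> x _; rewrite /= mulr1 nneseries_esumT//.
    apply: esum_ge; exists [set (label x).1]; first by split.
    rewrite fsbig_set1 /k /h; case: eqP => lx; last first.
      by rewrite mule_ge0 ?lee_fin ?expR_ge0.
    by rewrite indicE mem_set ?mule1// -lx; exact: label_cell.
  rewrite integral_nneseries//; apply: lee_nneseries => [a _ _|a _].
    by apply: integral_ge0.
  rewrite ge0_integralZl ?lee_fin ?expR_ge0//; last first.
    by apply/measurable_EFinP; apply: measurable_indic; exact: measurable_floor.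
  rewrite integral_indic ?setIT; [|by []|exact: measurable_floor].
  rewrite -(mu_floor (top a)) lee_wpmul2r ?measure_ge0// lee_fin ler_expR.
  by rewrite ler_wpM2l ?(ltW c0_gt0)// ler_nat leq_pred.
have m1 : measurable_fun [set: X] (fun x => ((\esum_(y in T @^-1` [set x])
    (g y * (h \o label) y)%:E) * 1%:E)%E).
  rewrite (_ : (fun _ => _) = fun x =>
    (\esum_(y in T @^-1` [set x]) (g y * (h \o label) y)%:E)%E); last first.
    by apply/funext => x; rewrite mule1.
  apply: (@measurable_esum_preimage (fun y => g y * (h \o label) y)).
    by apply: measurable_funM => //; exact: inv_jac_measurable.
  by move=> x; rewrite /= mulr_ge0 ?h0// ltW.
apply: (@le_trans _ _ (\int[mu]_(x in base) (cst +oo%E) x)%E).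
  by rewrite integral_cst ?gt0_mulye ?mu_base_gt0//; exact: measurable_base.
rewrite (eq_integral (fun x => (\esum_(y in T @^-1` [set x])
    (g y * (h \o label) y)%:E) * 1%:E)%E); last first.
  move=> x; rewrite inE => /baseE lx; rewrite mule1 (@esum_preimage_base _ _ _ _ _ Y)//=.
  rewrite -(inf x lx); apply: eq_esum => a _.
  by rewrite /h label_pre_base//= eqxx.
apply: ge0_subset_integral => //; first exact: measurable_base.
move=> x _; rewrite mule1; apply: esum_ge0 => y _.
by rewrite lee_fin /= mulr_ge0 ?h0// ltW.
Qed.

End weights.
End tower_measure.

Section normalised.
Variables (R : realType) (d : measure_display) (X : measurableType d).
Variables (T : X -> X) (mu : probability X R) (Y : uniform_young_tower T mu).

Local Notation cell := (cell Y).
Local Notation phi := (phi Y).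
Local Notation beta := (beta Y).
Local Notation g := (inv_jac Y).
Local Notation dist := (tower_dist Y).
Local Notation label := (label Y).
Local Notation pre := (pre Y).

Variables (c0 Cg : R) (x0 : X).
Hypothesis c0_gt0 : 0 < c0.
Hypothesis Cg_ge0 : 0 <= Cg.
Hypothesis distortion : forall a l x y, (l < phi a)%N -> cell a l x -> cell a l y ->
  `|g x / g y - 1| <= Cg * dist (T x) (T y).
Hypothesis x0_base : (label x0).2 = 0%N.
Hypothesis x0_moment : (preimage_moment Y c0 x0 < +oo)%E.

Let g0 x : 0 < g x := inv_jac_gt0 Y x.
Let pm := preimage_moment Y c0.

Definition pre_mass (x : X) : R := fine (\esum_(y in T @^-1` [set x]) (g y)%:E).

(** The jacobian divided by its sum over the preimages of [x].  Above the base the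
    only preimage, whose index is [0], gets the mass [1]. *)
Definition nwt (x : X) (a : nat) : R :=
  if (label x).2 == 0%N then g (pre x a) / pre_mass x else (a == 0%N)%:R.

(** Preimages in the same column lie in the same cell. *)
Lemma jac_distort x x' a : (label x).2 = 0%N -> (label x').2 = 0%N ->
  g (pre x a) <= (1 + Cg * dist x x') * g (pre x' a).
Proof.
move=> lx lx'; rewrite -ler_pdivrMr// -[_ / _](subrK 1) addrC lerD2l.
have la : ((phi a).-1 < phi a)%N by rewrite prednK ?phi_gt0.
have c z : (label z).2 = 0%N -> cell a (phi a).-1 (pre z a).
  by move=> lz; have := label_cell Y (pre z a); rewrite label_pre_base.
have := distortion la (c x lx) (c x' lx'); rewrite !preK.
exact: le_trans (ler_norm _).
Qed.

Lemma jac_distort1 x x' a : (label x).2 = 0%N -> (label x').2 = 0%N ->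
  g (pre x a) <= (1 + Cg) * g (pre x' a).
Proof.
move=> lx lx'; apply: le_trans (jac_distort a lx lx') _.
by rewrite ler_wpM2r ?(ltW (g0 _))// lerD2l ler_piMr// tower_dist_le1.
Qed.

Let S0 : R := fine (pm x0).

Let pm_ge0 x : (0 <= pm x)%E.
Proof. by apply: esum_ge0 => a _; rewrite lee_fin mulr_ge0 ?expR_ge0// ltW. Qed.

Let S0E : pm x0 = S0%:E.
Proof. by rewrite fineK// ge0_fin_numE. Qed.

(** By distortion, finiteness at one point of the base gives a bound at all of
    them. *)
Lemma preimage_moment_le x : (label x).2 = 0%N -> (pm x <= ((1 + Cg) * S0)%:E)%E.
Proof.
move=> lx; rewrite EFinM -S0E /pm /preimage_moment -esumZl ?addr_ge0//.
  apply: le_esum => a _; rewrite -EFinM lee_fin mulrA ler_wpM2r ?expR_ge0//.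
  exact: jac_distort1.
by move=> a; rewrite lee_fin mulr_ge0 ?expR_ge0// ltW.
Qed.

Lemma pre_mass_base x : (label x).2 = 0%N ->
  (\esum_(a in [set: nat]) (g (pre x a))%:E = (pre_mass x)%:E)%E.
Proof.
move=> lx; rewrite /pre_mass (@esum_preimage_base _ _ _ _ _ Y)// fineK//.
rewrite ge0_fin_numE; last by apply: esum_ge0 => a _; rewrite lee_fin ltW.
apply: le_lt_trans (le_lt_trans (preimage_moment_le lx) (ltry _)).
apply: le_esum => a _; rewrite lee_fin ler_peMr ?(ltW (g0 _))//.
by rewrite -expR0 ler_expR mulr_ge0// ltW.
Qed.

Lemma pre_mass_up x : (label x).2 != 0%N -> pre_mass x = g (pre x 0%N).
Proof.
move=> lx; rewrite /pre_mass (@esum_preimage_up _ _ _ _ _ Y)// => y.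
by rewrite lee_fin ltW.
Qed.

Lemma pre_massE x : \esum_(y in T @^-1` [set x]) (g y)%:E = (pre_mass x)%:E.
Proof.
have [lx|lx] := eqVneq (label x).2 0%N.
  by rewrite -pre_mass_base// (@esum_preimage_base _ _ _ _ _ Y).
rewrite pre_mass_up// (@esum_preimage_up _ _ _ _ _ Y)// => y.
by rewrite lee_fin ltW.
Qed.

Lemma pre_mass_gt0 x : 0 < pre_mass x.
Proof.
have [lx|lx] := eqVneq (label x).2 0%N; last by rewrite pre_mass_up.
apply: lt_le_trans (g0 (pre x 0%N)) _; rewrite -lee_fin -pre_mass_base//.
apply: esum_ge; exists [set 0%N]; first by split.
by rewrite fsbig_set1.
Qed.

Lemma pre_mass_distort x x' : (label x).2 = 0%N -> (label x').2 = 0%N ->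
  pre_mass x <= (1 + Cg * dist x x') * pre_mass x'.
Proof.
move=> lx lx'; rewrite -lee_fin EFinM -!pre_mass_base// -esumZl.
- by apply: le_esum => a _; rewrite -EFinM lee_fin jac_distort.
- by rewrite addr_ge0// mulr_ge0// tower_dist_ge0.
- by move=> a; rewrite lee_fin ltW.
Qed.

Lemma nwt_pweight x : pweight (nwt x).
Proof.
have m0 := pre_mass_gt0 x.
rewrite /nwt; case: eqP => lx; split.
- by move=> a; rewrite divr_ge0// ltW.
- rewrite (eq_esum (b := fun a => ((pre_mass x)^-1)%:E * (g (pre x a))%:E)%E).
    rewrite esumZl ?invr_ge0 ?(ltW m0)//; last by move=> a; rewrite lee_fin ltW.
    by rewrite pre_mass_base// -EFinM mulVf// gt_eqF.
  by move=> a _; rewrite mulrC EFinM.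
- by move=> a; rewrite ler0n.
- rewrite (esumID [set 0%N]); last by move=> a _; rewrite lee_fin ler0n.
  rewrite setTI esum_set1 ?lee_fin// esum1 ?adde0//.
  by move=> a [_ /= /eqP/negbTE ->].
Qed.

(** The jacobian and its sum each contribute a factor [1 + Cg * dist]. *)
Lemma nwt_distort x x' a : (label x).2 = 0%N -> (label x').2 = 0%N ->
  nwt x a <= (1 + (2 * Cg + Cg ^+ 2) * dist x x') * nwt x' a.
Proof.
move=> lx lx'; rewrite /nwt lx lx' /=.
have m0 := pre_mass_gt0 x; have m0' := pre_mass_gt0 x'.
have d0 := tower_dist_ge0 Y x x'; have d1 := tower_dist_le1 Y x x'.
set D := 1 + Cg * dist x x'.
have D0 : 0 <= D by rewrite addr_ge0// mulr_ge0.
apply: (@le_trans _ _ (D * D * (g (pre x' a) / pre_mass x'))).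
  rewrite ler_pdivrMr// -!mulrA.
  have := pre_mass_distort lx' lx; rewrite (tower_dist_sym Y x') -/D => H.
  apply: le_trans (jac_distort a lx lx') _; rewrite -/D ler_wpM2l//.
  rewrite mulrCA ler_peMr ?(ltW (g0 _))// mulrCA ler_pdivlMl// mulr1.
  by rewrite mulrC (le_trans H)// mulrC.
rewrite ler_wpM2r ?divr_ge0 ?(ltW (g0 _)) ?(ltW m0')// /D.
have : Cg ^+ 2 * (dist x x' * dist x x') <= Cg ^+ 2 * dist x x'.
  by rewrite ler_wpM2l ?sqr_ge0// ler_piMl.
by lra.
Qed.

Definition tower_moment : R := 1 + (1 + Cg) * S0 / (pre_mass x0 / (1 + Cg)).

Let S00 : 0 <= S0. Proof. by rewrite -lee_fin -S0E. Qed.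

Lemma tower_moment_ge1 : 1 <= tower_moment.
Proof.
have C1 : 0 <= 1 + Cg by rewrite addr_ge0.
rewrite /tower_moment lerDl; apply: divr_ge0; first by rewrite mulr_ge0.
by apply: divr_ge0 => //; exact/ltW/pre_mass_gt0.
Qed.

Lemma nwt_moment x : (label x).2 = 0%N ->
  (\esum_(a in [set: nat]) ((nwt x a)%:E * (expR (c0 * (phi a).-1%:R))%:E)
   <= tower_moment%:E)%E.
Proof.
move=> lx; have m0 := pre_mass_gt0 x; have m00 := pre_mass_gt0 x0.
have C1 : 0 < 1 + Cg by rewrite ltr_wpDr.
apply: (@le_trans _ _ ((pre_mass x)^-1%:E * pm x)%E).
  rewrite /pm /preimage_moment -esumZl ?invr_ge0 ?(ltW m0)//; last first.
    by move=> a; rewrite lee_fin mulr_ge0 ?expR_ge0// ltW.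
  apply: le_esum => a _; rewrite /nwt lx eqxx -!EFinM lee_fin.
  by rewrite (mulrC (g _)) mulrA.
apply: (@le_trans _ _ ((pre_mass x)^-1%:E * ((1 + Cg) * S0)%:E)%E).
  by rewrite lee_wpmul2l ?lee_fin ?invr_ge0 ?(ltW m0)// preimage_moment_le.
rewrite -EFinM lee_fin /tower_moment mulrC ler_wpDl//.
rewrite ler_wpM2l ?mulr_ge0 ?(ltW C1)// lef_pV2 ?posrE ?divr_gt0//.
rewrite ler_pdivrMr// mulrC (le_trans (pre_mass_distort x0_base lx))//.
rewrite ler_wpM2r ?(ltW m0)// lerD2l ler_piMr//.
exact: tower_dist_le1.
Qed.

Lemma phi_gcd1 (k : nat) : (forall a, (k %| phi a)%N) -> k = 1%N.
Proof.
move=> kd; have [_ /(_ k kd)] := phi_gcd Y.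
by rewrite dvdn1 => /eqP.
Qed.

Lemma nwt_up x a : (label x).2 != 0%N -> nwt x a = (a == 0%N)%:R.
Proof. by move=> lx; rewrite /nwt (negbTE lx). Qed.

Lemma nwt_gt0 x a : (label x).2 = 0%N -> 0 < nwt x a.
Proof. by move=> lx; rewrite /nwt lx eqxx divr_gt0// pre_mass_gt0. Qed.

Lemma tower_dist_pre x y a b : label (pre x a) = label (pre y b) ->
  dist (pre x a) (pre y b) = beta * dist x y.
Proof. by move=> /tower_dist_step ->; rewrite !preK. Qed.

Definition young_backward : backward_tower R X :=
  @BackwardTower R X pre nwt label dist phi beta (2 * Cg + Cg ^+ 2) c0
    tower_moment x0 nwt_pweight nwt_up nwt_gt0 (label_pre_up (Y := Y))
    (label_pre_base (Y := Y)) x0_base (tower_dist_ge0 Y) (tower_dist_le1 Y)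
    (tower_dist_sym Y) (tower_dist_far (Y := Y)) tower_dist_pre (beta_itv Y)
    (addr_ge0 (mulr_ge0 (ler0n R 2) Cg_ge0) (sqr_ge0 Cg))
    nwt_distort c0_gt0 tower_moment_ge1 nwt_moment (phi_gt0 Y) phi_gcd1.

(** ** Invariance of the measure under the backward chain *)

Lemma backE (u : X -> R) x : (forall y, 0 <= u y) ->
  back young_backward (EFin \o u) x =
  ((pre_mass x)^-1%:E * \esum_(y in T @^-1` [set x]) (g y * u y)%:E)%E.
Proof.
move=> u0; have m0 := pre_mass_gt0 x.
have gu0 y : (0 <= (g y * u y)%:E)%E by rewrite lee_fin mulr_ge0// ltW.
have [lx|lx] := eqVneq (label x).2 0%N.
  rewrite (@esum_preimage_base _ _ _ _ _ Y)// -esumZl ?invr_ge0 ?(ltW m0)//.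
  apply: eq_esum => a _ /=; rewrite /nwt lx eqxx -!EFinM; congr EFin.
  by rewrite mulrA (mulrC (g _)).
rewrite back_up//=; last first.
- by rewrite lt0n.
rewrite (@esum_preimage_up _ _ _ _ _ Y)// pre_mass_up// -EFinM; congr EFin.
by rewrite mulrA mulVf ?mul1r// gt_eqF.
Qed.

Lemma measurable_pre_mass : measurable_fun [set: X] pre_mass.
Proof.
apply/measurable_EFinP.
rewrite (_ : _ \o _ = fun x => \esum_(y in T @^-1` [set x]) (g y)%:E : \bar R).
  apply: (measurable_esum_preimage Y); first exact: inv_jac_measurable.
  by move=> x; exact: ltW.
by apply/funext => x; rewrite pre_massE.
Qed.

(** Test the change of variables formula on the indicator of a set [E], and use the
    invariance of the measure. *)
Lemma pre_mass_ae1 : ae_eq mu [set: X] (EFin \o pre_mass) (cst 1%E).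
Proof.
apply: ae_eq_sym; apply: integral_ae_eq => //.
- exact: finite_measure_integrable_cst.
- by apply/measurable_EFinP; exact: measurable_pre_mass.
move=> E _ mE; rewrite integral_cst// mul1e.
have mi : measurable_fun [set: X] (\1_E : X -> R) by exact: measurable_indic.
have i0 x : 0 <= (\1_E x : R) by rewrite indicE.
have /= H := inv_jacE Y (measurable_cst (1 : R)) mi (fun=> ler01) i0.
transitivity (\int[mu]_x (1 * \1_E (T x) : R)%:E)%E.
  rewrite -(mu_invariant Y mE) -[T @^-1` E]setIT -integral_indic//; last first.
    by rewrite -[X in measurable X]setTI; exact: (measurable_step Y measurableT mE).
  by apply: eq_integral => x _; rewrite mul1r.
rewrite H [RHS]integral_mkcond; apply: eq_integral => x _.
under eq_esum do rewrite mulr1.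
rewrite pre_massE patchE indicE; case: ifP => _; first by rewrite mule1.
by rewrite mule0.
Qed.

Section transfer.
Variable u : X -> R.
Hypothesis mu_ : measurable_fun [set: X] u.
Hypothesis u0 : forall x, 0 <= u x.

Lemma measurable_back :
  measurable_fun [set: X] (back young_backward (EFin \o u)).
Proof.
rewrite (_ : back _ _ = fun x => ((pre_mass x)^-1%:E *
    \esum_(y in T @^-1` [set x]) (g y * u y)%:E)%E); last first.
  by apply/funext => x; exact: backE.
apply: emeasurable_funM.
  apply/measurable_EFinP.
  rewrite (_ : (fun _ => _) = (fun x => x `^ (-1)) \o pre_mass).
    by apply: measurableT_comp; [exact: measurable_powR|exact: measurable_pre_mass].
  by apply/funext => x /=; rewrite powR_inv1// ltW// pre_mass_gt0.
apply: (@measurable_esum_preimage _ _ _ _ _ Y (fun y => g y * u y)).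
  by apply: measurable_funM => //; exact: inv_jac_measurable.
by move=> x; rewrite mulr_ge0// ltW.
Qed.

Lemma integral_back :
  (\int[mu]_x (u x)%:E = \int[mu]_x back young_backward (EFin \o u) x)%E.
Proof.
have /= H := inv_jacE Y mu_ (measurable_cst (1 : R)) u0 (fun=> ler01).
transitivity (\int[mu]_x (u x * 1)%:E)%E.
  by apply: eq_integral => x _; rewrite mulr1.
have gu0 y : 0 <= g y * u y by rewrite mulr_ge0// ltW.
have E0 x : (0 <= \esum_(y in T @^-1` [set x]) (g y * u y)%:E)%E.
  by apply: esum_ge0 => y _; rewrite lee_fin.
rewrite H; apply: ge0_ae_eq_integral => //.
- apply: emeasurable_funM => //.
  apply: (@measurable_esum_preimage _ _ _ _ _ Y (fun y => g y * u y)) => //.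
  by apply: measurable_funM => //; exact: inv_jac_measurable.
- exact: measurable_back.
- by move=> x _; rewrite mule1.
- by move=> x _; apply: kernel_ge0 => [*|y]; [exact: wt_ge0|rewrite lee_fin].
apply: filterS pre_mass_ae1 => x /= m1 _.
move: (m1 Logic.I) => [m1']; by rewrite backE// m1' invr1 mul1e mule1.
Qed.

End transfer.
End normalised.

(** The tower as a backward chain with values in the same space, for which the measure
    is stationary. *)
Theorem young_backward_exists (R : realType) (d : measure_display)
    (X : measurableType d) (T : X -> X) (mu : probability X R)
    (Y : uniform_young_tower T mu) :
  exponential_tails Y ->
  exists S : backward_tower R X,
    [/\ dist S = tower_dist Y, forall x a, T (br S x a) = x &
    forall u : X -> R, measurable_fun [set: X] u -> (forall x, 0 <= u x) ->
      measurable_fun [set: X] (back S (EFin \o u)) /\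
      (\int[mu]_x (u x)%:E = \int[mu]_x back S (EFin \o u) x)%E].
Proof.
move=> [c0 c00 tails].
have [x0 [x0b x0m]] := preimage_moment_finite c00 tails.
have [Cg Cgd] := inv_jac_distortion Y.
have Cg' a l x y : (l < phi Y a)%N -> cell Y a l x -> cell Y a l y ->
    `|inv_jac Y x / inv_jac Y y - 1| <= `|Cg| * tower_dist Y (T x) (T y).
  move=> la cx cy; apply: le_trans (Cgd a l x y la cx cy) _.
  by rewrite ler_wpM2r ?ler_norm//; exact: tower_dist_ge0.
exists (young_backward c00 (normr_ge0 Cg) Cg' x0b x0m); split => //.
  by move=> x a; exact: preK.
move=> u mu_ u0; split; first exact: measurable_back.
exact: integral_back.
Qed.

(** * Measurability of functionals of an orbit *)

Section cylinders.
Variables (R : realType) (d : measure_display) (X : measurableType d).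
Variables (T : X -> X) (mu : probability X R) (Y : uniform_young_tower T mu).

Local Notation label := (label Y).

(** A function which is uniformly close to constant on long cylinders is
    measurable, since the cylinders are measurable and countably many. *)
Lemma measurable_cylinder_continuous (k : X -> R) :
  (forall e, 0 < e -> exists N, forall x y,
    (forall m, (m < N)%N -> label (iter m T x) = label (iter m T y)) ->
    k x - k y < e) ->
  measurable_fun [set: X] k.
Proof.
move=> kc; apply: (measurability _ (RGenOInfty.measurableE R)) => //.
move=> _ [_ [a ->] <-]; rewrite setTI.
pose cyl (w : seq (nat * nat)) := [set x | forall m, (m < size w)%N ->
  label (iter m T x) = nth (0, 0)%N w m].
have mcyl w : measurable (cyl w).
  rewrite (_ : cyl w = \bigcap_(m in [set m | (m < size w)%N])
      ((iter m T) @^-1` (label @^-1` [set nth (0, 0)%N w m]))).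
    apply: bigcap_measurableType => m _; rewrite -[X in measurable X]setTI.
    by apply: (measurable_iter_step Y) => //; exact: (measurable_label Y).
  by apply/seteqP; split.
rewrite (_ : _ @^-1` _ = \bigcup_(w in [set w | cyl w `<=` k @^-1` `]a, +oo[])
    cyl w).
  rewrite bigcup_mkcond; apply: countable_bigcupT_measurable => // w.
  by case: ifP.
apply/seteqP; split=> x /=; last by move=> [w]; exact.
rewrite in_itv/= andbT => ax.
have [|N NP] := kc (k x - a); first by rewrite subr_gt0.
exists (mkseq (fun m => label (iter m T x)) N) => /=.
  move=> y cy /=; rewrite in_itv/= andbT.
  have : k x - k y < k x - a.
    apply: NP => m mN; have := cy m; rewrite size_mkseq => /(_ mN) ->.
    by rewrite nth_mkseq.
  by rewrite ltrD2l ltrN2.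
by move=> m; rewrite size_mkseq => mN; rewrite nth_mkseq.
Qed.

Lemma tower_dist_agree N x y :
  (forall m, (m < N)%N -> label (iter m T x) = label (iter m T y)) ->
  tower_dist Y x y <= beta Y ^+ N.
Proof.
elim: N x y => [|N IH] x y xy; first by rewrite expr0 tower_dist_le1.
rewrite (tower_dist_step (xy 0%N isT)) exprS ler_wpM2l ?(ltW (beta_gt0 Y))//.
by apply: IH => m mN; rewrite -!iterSr; exact: xy.
Qed.

(** ** Separately Lipschitz functions *)

(** Change the coordinates one at a time. *)
Lemma separately_lipschitz_sum n (K : ('I_n -> X) -> R) Lip x y :
  separately_lipschitz (tower_dist Y) K Lip ->
  `|K x - K y| <= \sum_(i < n) Lip i * tower_dist Y (x i) (y i).
Proof.
move=> KL.
pose z m (i : 'I_n) := if (i < m)%N then y i else x i.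
have H m : `|K x - K (z m)| <=
    \sum_(i < n | (i < m)%N) Lip i * tower_dist Y (x i) (y i).
  elim: m => [|m IH].
    by rewrite big_pred0// (_ : z 0%N = x) ?subrr ?normr0//; apply/funext.
  have [mn|nm] := ltnP m n; last first.
    rewrite (_ : z m.+1 = z m); last first.
      apply/funext => i; rewrite /z.
      by rewrite (leq_trans (ltn_ord i) nm) ltnS (leq_trans (ltnW (ltn_ord i)) nm).
    rewrite (eq_bigl (fun i : 'I_n => (i < m)%N))// => i.
    by rewrite (leq_trans (ltn_ord i) nm) ltnS (leq_trans (ltnW (ltn_ord i)) nm).
  rewrite (bigD1 (Ordinal mn))//=.
  rewrite (eq_bigl (fun i : 'I_n => (i < m)%N)); last first.
    by move=> i; rewrite -val_eqE/= ltnS [RHS]ltn_neqAle andbC.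
  rewrite addrC -(subrKA (K (z m))) (le_trans (ler_normD _ _))// lerD//.
  have zm : z m (Ordinal mn) = x (Ordinal mn) by rewrite /z /= ltnn.
  have zm1 : z m.+1 (Ordinal mn) = y (Ordinal mn) by rewrite /z /= ltnSn.
  rewrite -[in leRHS]zm -zm1; apply: KL => j; rewrite -val_eqE/= => jm.
  by rewrite /z [in RHS]ltnS [in RHS]leq_eqVlt (negbTE jm).
have := H n; rewrite (_ : z n = y); last by apply/funext => i; rewrite /z ltn_ord.
by move/le_trans; apply; rewrite le_eqVlt; apply/orP; left; apply/eqP;
  apply: eq_bigl => i; rewrite ltn_ord.
Qed.

(** Points with a long common itinerary have close orbits.  Some coordinates, those
    selected by [b], may be frozen at [x0]. *)
Lemma measurable_functional n (K : ('I_n -> X) -> R) Lip (b : pred 'I_n) x0 :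
  separately_lipschitz (tower_dist Y) K Lip -> (forall i, 0 <= Lip i) ->
  measurable_fun [set: X] (fun x => K (fun i => if b i then x0 else iter i T x)).
Proof.
move=> KL L0; apply: measurable_cylinder_continuous => e e0.
pose s := \sum_(i < n) Lip i.
have s0 : 0 <= s by apply: sumr_ge0.
have s1 : 0 < s + 1 by rewrite ltr_wpDl.
have [N NP] : exists N, beta Y ^+ N <= e / 2 / (s + 1).
  by apply: exprn_le_small; rewrite ?divr_gt0// beta_lt1 ltW// beta_gt0.
exists (n + N)%N => x y xy.
have bN : 0 <= beta Y ^+ N by rewrite exprn_ge0// ltW// beta_gt0.
apply: le_lt_trans (ler_norm _) _; apply: le_lt_trans (separately_lipschitz_sum _ _ KL) _.
apply: (@le_lt_trans _ _ (\sum_(i < n) Lip i * beta Y ^+ N)).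
  apply: ler_sum => i _; rewrite ler_wpM2l//; case: ifP => _.
    apply: tower_dist_agree => //.
  apply: tower_dist_agree => m mN; rewrite -!iterD; apply: xy.
  by rewrite addnC -addnS leq_add// ltnW.
rewrite -mulr_suml -/s; have : s * beta Y ^+ N <= s * (e / 2 / (s + 1)).
  by rewrite ler_wpM2l.
move/le_lt_trans; apply; rewrite mulrCA -[ltRHS]mulr1.
have : s / (s + 1) <= 1 by rewrite ler_pdivrMr// mul1r lerDl.
by move: (s / (s + 1)) => q; nra.
Qed.

End cylinders.

(** * Concentration *)

Lemma bounded_cvg_integral (R : realType) (d : measure_display)
    (X : measurableType d) (mu : probability X R) (w : nat -> X -> R) (B c : R) :
  (forall N, measurable_fun [set: X] (w N)) ->
  (forall N x, `|w N x| <= B) ->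
  (forall x, w N x @[N --> \oo] --> c) ->
  (\int[mu]_x w N x)%R @[N --> \oo] --> c.
Proof.
move=> mw wB wc.
have mE N : measurable_fun [set: X] (EFin \o w N) by exact/measurable_EFinP.
have cE : {ae mu, forall x, [set: X] x ->
    (fun N => (EFin \o w N) x) @ \oo --> (cst c%:E) x}.
  by apply: aeW => x _; apply: cvg_EFin; [exact: nearW|exact: wc].
have dom : {ae mu, forall x N, [set: X] x -> (`|(EFin \o w N) x| <= (cst B%:E) x)%E}.
  by apply: aeW => x N _; rewrite /= lee_fin.
have ig : mu.-integrable [set: X] (cst B%:E) by exact: finite_measure_integrable_cst.
have [_ _] := dominated_convergence measurableT mE (measurable_cst _) cE ig dom.
rewrite integral_cst// [X in (_ * X)%E](_ : _ = 1%E) ?mule1; last exact: probability_setT.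
move=> H.
exact: (fine_cvg H).
Qed.

Section concentration.
Variables (R : realType) (d : measure_display) (X : measurableType d).
Variables (T : X -> X) (mu : probability X R) (S : backward_tower R X).
Hypothesis br_step : forall x a, T (br S x a) = x.
Hypothesis transfer : forall u : X -> R, measurable_fun [set: X] u ->
  (forall x, 0 <= u x) ->
  measurable_fun [set: X] (back S (EFin \o u)) /\
  (\int[mu]_x (u x)%:E = \int[mu]_x back S (EFin \o u) x)%E.

Definition orbit (x : X) (i : nat) : X := iter i T x.

Lemma orbit_br x a : scons (br S x a) (orbit x) = orbit (br S x a).
Proof. by apply/funext => -[|i] //=; rewrite /orbit -[RHS]/(iter i.+1 T _) iterSr br_step. Qed.

Section functional.
Variables (B : R) (f : (nat -> X) -> R).
Hypothesis f_bounded : bounded_by B f.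
Hypothesis f_measurable : measurable_fun [set: X] (f \o orbit).

Definition avg p (x : X) : R := iter p (cond S) f (orbit x).

Lemma avg_itv p x : 0 <= avg p x <= B.
Proof. exact: iter_cond_bounded. Qed.

Lemma avgS p x : (avg p.+1 x)%:E = back S (EFin \o avg p) x.
Proof.
rewrite /avg iterS (condE S _ (iter_cond_bounded S p f_bounded)).
by apply: eq_esum => a _ /=; rewrite orbit_br.
Qed.

Lemma measurable_avg p : measurable_fun [set: X] (avg p).
Proof.
elim: p => [|p IH]; first exact: f_measurable.
have [|H _] := transfer IH; first by move=> x; case/andP: (avg_itv p x).
apply/measurable_EFinP; move: H; congr (measurable_fun _ _).
by apply/funext => x; rewrite /= avgS.
Qed.

Lemma integral_avg p : (\int[mu]_x (avg p x)%:E = \int[mu]_x (avg 0 x)%:E)%E.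
Proof.
elim: p => // p <-; have [|_ ->] := transfer (measurable_avg p).
  by move=> x; case/andP: (avg_itv p x).
by apply: eq_integral => x _; rewrite avgS.
Qed.

(** Once the [n] coordinates on which [f] depends have been averaged out, only the
    starting point of the chain remains. *)
Lemma avg_first_coordinate n p x r :
  (forall xi xi', (forall i, (i < n)%N -> xi i = xi' i) -> f xi = f xi') ->
  (n <= p)%N -> avg p x = iter p (cond S) f (scons x r).
Proof.
move=> fn np.
have H q xi xi' : xi 0%N = xi' 0%N -> (forall i, (q + i < n)%N -> xi i = xi' i) ->
    iter q (cond S) f xi = iter q (cond S) f xi'.
  elim: q xi xi' => [|q IH] xi xi' x0 E; first exact: fn.
  rewrite !iterS /cond x0; congr fine; apply: eq_esum => a _.
  congr (_ * EFin _)%E; apply: IH => // -[|i] //=.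
  by rewrite addnS -addSn => /E.
by apply: H => // i pi; have := leq_trans (leq_ltn_trans (leq_addr i p) pi) np;
  rewrite ltnn.
Qed.

End functional.

(** The exponential moment is pushed backwards in time, at the cost [past_sqr] for
    each step; after many steps the conditional expectation is almost constant. *)
Lemma small_concentration (eps K rho : R) (G : X -> X -> R) B f lip n :
  0 <= K -> 0 < rho < 1 -> (forall x y, 0 <= G x y) ->
  bounded_by B f -> measurable_fun [set: X] (f \o orbit) ->
  (forall j, 0 <= lip j <= eps) -> (forall j, (n <= j)%N -> lip j = 0) ->
  (forall xi xi', (forall i, (i < n)%N -> xi i = xi' i) -> f xi = f xi') ->
  (forall p xi,
    (back S (fun y => (expR (iter p (cond S) f (scons y xi)))%:E) (xi 0%N) <=
      (expR (iter p.+1 (cond S) f xi + K * past_sqr rho lip p))%:E)%E /\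
    forall y y', iter p (cond S) f (scons y xi) <=
      iter p (cond S) f (scons y' xi) +
      (\sum_(j < p.+1) lip j * rho ^+ (p - j)) * G y y') ->
  (\int[mu]_x (expR (f (orbit x)))%:E <=
    (expR (\int[mu]_x f (orbit x) + K / (1 - rho) * \sum_(j < n) lip j ^+ 2))%:E)%E.
Proof.
move=> K0 rho_itv G0 fB mf lipP lip0 fn step.
have /andP[r0 r1] := rho_itv.
pose v := avg f.
have mv p : measurable_fun [set: X] (v p) by exact: measurable_avg fB mf p.
have v_itv p x : 0 <= v p x <= B by exact: avg_itv.
have me p : measurable_fun [set: X] (fun x => expR (v p x)).
  by apply: measurableT_comp => //; exact: measurable_expR.
have push p : (\int[mu]_x (expR (v 0%N x))%:E <=
    (expR (K * \sum_(q < p) past_sqr rho lip q))%:E *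
    \int[mu]_x (expR (v p x))%:E)%E.
  elim: p => [|p IH]; first by rewrite big_ord0 mulr0 expR0 mul1e.
  apply: le_trans IH _; rewrite big_ord_recr/= mulrDr expRD EFinM -muleA.
  rewrite lee_wpmul2l ?lee_fin ?expR_ge0//.
  have [|mb ->] := transfer (me p); first by move=> x; exact: expR_ge0.
  have mE : measurable_fun [set: X] (fun x => (expR (v p.+1 x))%:E).
    by apply/measurable_EFinP.
  rewrite -ge0_integralZl ?lee_fin ?expR_ge0//.
  apply: ge0_le_integral => //.
  - by move=> x _; apply: kernel_ge0 => [*|y]; [exact: wt_ge0|rewrite lee_fin expR_ge0].
  - exact: measurable_funeM.
  move=> x _; have [H _] := step p (orbit x).
  rewrite -EFinM -expRD addrC; apply: le_trans H.
  by rewrite le_eqVlt; apply/orP; left; apply/eqP; apply: eq_esum => a _;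
    rewrite /= orbit_br.
have sqr_le p : (n <= p)%N ->
    \sum_(q < p) past_sqr rho lip q <= (1 - rho)^-1 * \sum_(j < n) lip j ^+ 2.
  move=> np; apply: le_trans (past_sqr_sum_le lip p rho_itv) _.
  rewrite ler_wpM2l ?invr_ge0 ?subr_ge0 ?(ltW r1)//.
  rewrite -(big_mkord xpredT (fun j => lip j ^+ 2)) (@big_cat_nat _ _ _ n)//=.
  rewrite big_mkord [X in _ + X]big_nat_cond [X in _ + X]big1 ?addr0// => j /andP[/andP[nj _] _].
  by rewrite lip0// expr0n.
(* The reference point is arbitrary: the oscillations of [v p] tend to [0]. *)
pose x0 := base_pt S.
pose w p x := v (n + p)%N x - v (n + p)%N x0.
have v_osc p x y : `|v (n + p)%N x - v (n + p)%N y| <=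
    (\sum_(j < n) eps) * (G x y + G y x) * rho ^+ p.
  have dl : \sum_(j < (n + p).+1) lip j * rho ^+ (n + p - j) <=
      (\sum_(j < n) eps) * rho ^+ p.
    rewrite -(big_mkord xpredT (fun j => lip j * rho ^+ (n + p - j))).
    rewrite (@big_cat_nat _ _ _ n)//= ?(leq_trans (leq_addr p n))//.
    rewrite [X in _ + X]big_nat_cond [X in _ + X]big1 ?addr0; last first.
      by move=> j /andP[/andP[nj _] _]; rewrite lip0// mul0r.
    rewrite big_mkord mulr_suml; apply: ler_sum => j _.
    have /andP[l0 le] := lipP j; rewrite ler_pM ?exprn_ge0 ?(ltW r0)//.
    by rewrite ler_wiXn2l ?(ltW r0) ?(ltW r1)// -addnBAC ?leq_addl// ltnW.
  have one z z' : v (n + p)%N z <= v (n + p)%N z' +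
      (\sum_(j < n) eps) * rho ^+ p * G z z'.
    rewrite /v (avg_first_coordinate z (orbit x0) fn (leq_addr p n)).
    rewrite (avg_first_coordinate z' (orbit x0) fn (leq_addr p n)).
    have [_ H] := step (n + p)%N (orbit x0).
    by apply: le_trans (H z z') _; rewrite lerD2l ler_wpM2r.
  have e0 : 0 <= (\sum_(j < n) eps) * rho ^+ p.
    rewrite mulr_ge0 ?exprn_ge0 ?(ltW r0)// sumr_ge0// => j _.
    by have /andP[/le_trans] := lipP j; apply.
  have := mulr_ge0 e0 (G0 x y); have := mulr_ge0 e0 (G0 y x).
  have := one x y; have := one y x; rewrite ler_distl.
  by move=> H1 H2 H3 H4; apply/andP; split; lra.
have rho_cvg : rho ^+ p @[p --> \oo] --> (0 : R).
  by apply: cvg_expr; rewrite ger0_norm// ltW.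
have w_cvg x : w p x @[p --> \oo] --> (0 : R).
  apply/cvgr0Pnorm_lt => e e0.
  have : (\sum_(j < n) eps) * (G x x0 + G x0 x) * rho ^+ p @[p --> \oo] --> (0 : R).
    by rewrite -[X in _ --> X](mulr0 ((\sum_(j < n) eps) * (G x x0 + G x0 x)));
      apply: cvgMr.
  move=> /cvgr0Pnorm_lt/(_ e e0); apply: filterS => p; apply: le_lt_trans.
  exact: le_trans (v_osc p x x0) (ler_norm _).
have wB p x : `|w p x| <= B.
  by rewrite ler_distl; have := v_itv (n + p)%N x; have := v_itv (n + p)%N x0; lra.
have mw p : measurable_fun [set: X] (w p) by exact: measurable_funB.
pose a p := (\int[mu]_x w p x)%R; pose b p := (\int[mu]_x expR (w p x))%R.
have a_cvg : a p @[p --> \oo] --> (0 : R) by exact: bounded_cvg_integral wB w_cvg.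
have b_cvg : b p @[p --> \oo] --> (1 : R).
  apply: (@bounded_cvg_integral _ _ _ _ _ (expR B)) => [p|p x|x].
  - by apply: measurableT_comp => //; exact: measurable_expR.
  - by rewrite ger0_norm ?expR_ge0// ler_expR (le_trans (ler_norm _)).
  - by rewrite -expR0; apply: continuous_cvg; [exact: continuous_expR|exact: w_cvg].
set E := K / (1 - rho) * _; set I := (\int[mu]_x f (orbit x))%R.
have vint p : mu.-integrable [set: X] (EFin \o v p).
  apply: measurable_bounded_integrable => //.
    by rewrite [ltLHS](_ : _ = 1%E) ?ltry//; exact: probability_setT.
  exists B; split; first exact: num_real.
  by move=> M BM x _ /=; rewrite (le_trans _ (ltW BM))// ger0_norm; case/andP: (v_itv p x).
have Iv p : I = (\int[mu]_x v p x)%R.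
  by rewrite /I /Rintegral -(integral_avg fB mf p).
have aE p : a p = I - v (n + p)%N x0.
  rewrite /a /w RintegralB//; last exact: finite_measure_integrable_cst.
  rewrite -Iv Rintegral_cst// [X in fine X](_ : _ = 1%E) ?mulr1//.
  exact: probability_setT.
have bE p : (\int[mu]_x (expR (v (n + p)%N x))%:E =
    (expR (v (n + p)%N x0) * b p)%:E)%E.
  rewrite EFinM /b /Rintegral fineK; last first.
    apply: integrable_fin_num => //; apply: measurable_bounded_integrable => //.
    - by rewrite [ltLHS](_ : _ = 1%E) ?ltry//; exact: probability_setT.
    - by apply: measurableT_comp => //; exact: measurable_expR.
    exists (expR B); split; first exact: num_real.
    move=> M BM x _ /=; rewrite (le_trans _ (ltW BM))// ger0_norm ?expR_ge0//.
    by rewrite ler_expR (le_trans (ler_norm _)).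
  rewrite -ge0_integralZl ?lee_fin ?expR_ge0//.
    by apply: eq_integral => x _; rewrite -EFinM -expRD addrC subrK.
  by apply/measurable_EFinP; apply: measurableT_comp => //; exact: measurable_expR.
have main p : (\int[mu]_x (expR (v 0%N x))%:E <=
    (expR E * expR I * (expR (- a p) * b p))%:E)%E.
  apply: le_trans (push (n + p)%N) _; rewrite bE -EFinM lee_fin.
  have b0 : 0 <= b p by apply: Rintegral_ge0 => x _; exact: expR_ge0.
  rewrite (_ : expR E * _ * _ = expR E * (expR (v (n + p)%N x0) * b p)); last first.
    rewrite (_ : v (n + p)%N x0 = I + - a p); last by rewrite aE; ring.
    by rewrite expRD !mulrA.
  rewrite ler_wpM2r ?mulr_ge0 ?expR_ge0// ler_expR /E -mulrA ler_wpM2l//.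
  by apply: sqr_le; exact: leq_addr.
have lim_cvg : expR E * expR I * (expR (- a p) * b p) @[p --> \oo] -->
    (expR E * expR I * (1 * 1) : R).
  apply: cvgMr; apply: cvgM => //; rewrite -expR0; apply: continuous_cvg; first exact: continuous_expR.
  by rewrite -oppr0; apply: cvgN.
rewrite -/v (_ : (fun x => _) = fun x => (expR (v 0%N x))%:E)//.
have fin : (\int[mu]_x (expR (v 0%N x))%:E)%E \is a fin_num.
  rewrite ge0_fin_numE; first exact: le_lt_trans (main 0%N) (ltry _).
  by apply: integral_ge0 => x _; rewrite lee_fin expR_ge0.
rewrite -(fineK fin) lee_fin addrC expRD -[leRHS]mulr1 -[X in _ * X](mulr1 1).
apply: cvgr_to_ge lim_cvg _; apply: nearW => p.
by rewrite -lee_fin fineK.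
Qed.

End concentration.

Theorem theorem3p1 (R : realType) (d : measure_display) (X : measurableType d)
    (T : X -> X) (mu : probability X R) (Y : uniform_young_tower T mu) :
  exponential_tails Y ->
  exists2 C : R, 0 < C &
    forall (n : nat) (K : ('I_n -> X) -> R) (Lip : 'I_n -> R),
      (1 <= n)%N ->
      separately_lipschitz (tower_dist Y) K Lip ->
      (\int[mu]_x (expR (K (orbit_segment T x)))%:E
        <= (expR (\int[mu]_x K (orbit_segment T x))
            * expR (C * \sum_(i < n) Lip i ^+ 2))%:E)%E.
Proof.
move=> tails.
have [S [dS brS transfer]] := young_backward_exists tails.
have [eps [Kc [rho [G [eps0 K0 rho_itv G0 conc]]]]] := backward_concentration S.
have /andP[rho0 rho1] := rho_itv.
have Kr0 : 0 <= Kc / (1 - rho) by rewrite divr_ge0// subr_ge0 ltW.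
exists (Kc / (1 - rho) + 2 / eps); first by rewrite ltr_wpDl// divr_gt0.
move=> n K Lip _ KLip.
(* A negative constant is admissible only when all distances vanish. *)
pose L i : R := `|Lip i|.
have L0 i : 0 <= L i by exact: normr_ge0.
have KL : separately_lipschitz (tower_dist Y) K L.
  move=> i x x' xx'; apply: le_trans (KLip i x x' xx') _.
  by rewrite ler_wpM2r ?ler_norm// tower_dist_ge0.
(* The coordinates with a large constant are frozen at [xs]. *)
pose big (i : 'I_n) := eps < L i.
pose xs := base_pt S.
pose trunc (xi : nat -> X) (i : 'I_n) := if big i then xs else xi i.
pose B0 : R := \sum_(i < n) L i.
have osc x y : `|K x - K y| <= B0.
  apply: le_trans (separately_lipschitz_sum _ _ KL) _; apply: ler_sum => i _.
  by rewrite ler_piMr// tower_dist_le1.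
(* This constant makes the functional nonnegative. *)
pose c : R := B0 - K (fun=> xs).
pose f xi := K (trunc xi) + c.
pose lip j : R := if insub j is Some i then if big i then 0 else L i else 0.
have fB : bounded_by (2 * B0) f.
  move=> xi; have := osc (trunc xi) (fun=> xs).
  by rewrite ler_distl /f /c => /andP[H1 H2]; apply/andP; split; lra.
have lipP j : 0 <= lip j <= eps.
  rewrite /lip; case: insub => [i|]; last by rewrite lexx ltW.
  by rewrite /big; case: ltP => Li; [rewrite lexx ltW|rewrite L0].
have lip_out j : (n <= j)%N -> lip j = 0.
  by move=> nj; rewrite /lip insubF// ltnNge nj.
have f_lip : seq_lipschitz S lip f.
  move=> i xi xi' E; rewrite dS.
  have same : (forall j : 'I_n, val j = i -> big j) -> f xi = f xi'.
    move=> H; rewrite /f; congr (K _ + _); apply/funext => j; rewrite /trunc.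
    case: ifPn => // jb; apply: E; apply: contra jb => /eqP; exact: H.
  rewrite /lip; case: insubP => [j _ ji|ni].
    case: ifPn => jb.
      by rewrite same ?mul0r ?addr0// => k ki; rewrite (_ : k = j)//; apply: val_inj; rewrite ki.
    have tj z : trunc z j = z i by rewrite /trunc (negbTE jb) ji.
    have := KL j (trunc xi) (trunc xi'); rewrite !tj.
    have agree k : k != j -> trunc xi k = trunc xi' k.
      by move=> kj; rewrite /trunc E// -ji.
    move=> /(_ agree); rewrite ler_distl /f => /andP[_ H]; lra.
  rewrite same ?mul0r ?addr0// => j ji; move: ni; rewrite -ji ltn_ord//.
have f_loc xi xi' : (forall i, (i < n)%N -> xi i = xi' i) -> f xi = f xi'.
  move=> E; rewrite /f; congr (K _ + _); apply/funext => i.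
  by rewrite /trunc E// ltn_ord.
have mf : measurable_fun [set: X] (f \o orbit T).
  apply: measurable_funD => //.
  exact: (measurable_functional big xs KL L0).
have small := small_concentration brS transfer K0 rho_itv G0 fB mf lipP lip_out f_loc
  (conc _ _ _ fB f_lip lipP).
pose t : R := \sum_(i < n) if big i then L i else 0.
have dev x : `|K (orbit_segment T x) - K (trunc (orbit T x))| <= t.
  apply: le_trans (separately_lipschitz_sum _ _ KL) _; apply: ler_sum => i _.
  rewrite /trunc; case: ifP => _; first by rewrite ler_piMr// tower_dist_le1.
  by rewrite tower_distxx mulr0.
have cost : 2 * t + Kc / (1 - rho) * \sum_(j < n) lip j ^+ 2 <=
    (Kc / (1 - rho) + 2 / eps) * \sum_(i < n) Lip i ^+ 2.
  have L2 i : Lip i ^+ 2 = L i ^+ 2 by rewrite real_normK// num_real.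
  rewrite [leLHS]addrC [leRHS]mulrDl; apply: lerD.
    rewrite ler_wpM2l//; apply: ler_sum => j _; rewrite L2 /lip valK.
    by case: ifP => // _; rewrite expr0n/= sqr_ge0.
  rewrite mulr_sumr mulr_sumr; apply: ler_sum => i _; rewrite L2.
  case: ifP => [bi|_]; last by rewrite mulr0 mulr_ge0 ?sqr_ge0// divr_ge0// ltW.
  rewrite -mulrA ler_wpM2l// ler_pdivlMl// expr2.
  by rewrite ler_wpM2r// ltW.
set I := (\int[mu]_x K (orbit_segment T x))%R.
have mK : measurable_fun [set: X] (fun x => K (orbit_segment T x)).
  exact: (measurable_functional pred0 xs KL L0).
have bounded_int (u : X -> R) (b : R) : measurable_fun [set: X] u ->
    (forall x, `|u x| <= b) -> mu.-integrable [set: X] (EFin \o u).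
  move=> mu_ ub; apply: measurable_bounded_integrable => //.
    by rewrite [ltLHS](_ : _ = 1%E) ?ltry//; exact: probability_setT.
  exists b; split; first exact: num_real.
  by move=> M bM x _ /=; rewrite (le_trans _ (ltW bM)).
have If : (\int[mu]_x f (orbit T x))%R <= I + t + c.
  have iK : mu.-integrable [set: X] (EFin \o fun x => K (orbit_segment T x)).
    apply: (bounded_int _ (B0 + `|K (fun=> xs)|)) => // x.
    have := osc (orbit_segment T x) (fun=> xs); have := ler_normD
      (K (orbit_segment T x) - K (fun=> xs)) (K (fun=> xs)); rewrite subrK; lra.
  have ic : mu.-integrable [set: X] (EFin \o cst (t + c)).
    exact: finite_measure_integrable_cst.
  apply: (@le_trans _ _ (\int[mu]_x (K (orbit_segment T x) + (t + c) : R))%R).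
    apply: le_Rintegral => //.
    - apply: (bounded_int _ (2 * B0)) => // x.
      by have /andP[f0 fb] := fB (orbit T x); rewrite /= ger0_norm.
    - rewrite (_ : _ \o _ = ((EFin \o fun x => K (orbit_segment T x)) \+
        (EFin \o cst (t + c)%R))%E)//.
      exact: integrableD.
    move=> x _; have := dev x; rewrite ler_distl /f => /andP[H _]; lra.
  rewrite RintegralD// Rintegral_cst// [X in fine X](_ : _ = 1%E) ?mulr1 ?addrA//.
  exact: probability_setT.
apply: (@le_trans _ _ ((expR (t - c))%:E * \int[mu]_x (expR (f (orbit T x)))%:E)%E).
  have me : measurable_fun [set: X] (fun x => (expR (f (orbit T x)))%:E).
    by apply/measurable_EFinP; apply: measurableT_comp => //; exact: measurable_expR.
  rewrite -ge0_integralZl ?lee_fin ?expR_ge0//.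
  apply: ge0_le_integral => //.
  - by apply/measurable_EFinP; apply: measurableT_comp => //; exact: measurable_expR.
  - exact: measurable_funeM.
  move=> x _; rewrite -EFinM -expRD lee_fin ler_expR.
  by have := dev x; rewrite ler_distl /f => /andP[_ H]; lra.
apply: le_trans (lee_wpmul2l _ small) _; first by rewrite lee_fin expR_ge0.
rewrite -EFinM -!expRD lee_fin ler_expR.
by move: If cost; lra.
Qed.
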